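(* Let $f=h+\overline g$ be a locally univalent orientation-preserving harmonic mapping of the unit disk $\mathbb{D}$ (with $h,g$ analytic in $\mathbb{D}$) whose dilatation $g'/h'$ is the square of an analytic function in $\mathbb{D}$. Then $\|\mathcal{S}f\|<\infty$ if and only if $\|\mathcal{S}h\|<\infty$. In particular, $\|\mathcal{S}f\|<\infty$ if $h$ is univalent.
   Context: $\mathbb{D}=\{z\in\mathbb{C}:|z|<1\}$. A harmonic mapping is a complex-valued harmonic function, $f=h+\overline g$ with $h,g$ analytic in $\mathbb{D}$. It is locally univalent and orientation-preserving when $|h'(z)|>|g'(z)|$ for all $z\in\mathbb{D}$; equivalently $h'(z)\neq0$ and the dilatation $\omega=g'/h'$ satisfies $|\omega(z)|<1$ in $\mathbb{D}$. Thus here $g'/h'=q^2$ with $q$ analytic and $|q(z)|<1$ in $\mathbb{D}$. The Schwarzian derivative of such a harmonic mapping is $\mathcal{S}f=2(\sigma_{zz}-\sigma_z^2)$, where $\sigma=\log(|h'|+|g'|)$ and $\sigma_z=\frac12\left(\frac{\partial\sigma}{\partial x}-i\frac{\partial\sigma}{\partial y}\right)$, $z=x+iy$. For an analytic locally univalent function $h$ this reduces to the classical Schwarzian $\mathcal{S}h=(h''/h')'-\frac12(h''/h')^2$. The Schwarzian norm is $\|\mathcal{S}f\|=\sup_{z\in\mathbb{D}}(1-|z|^2)^2|\mathcal{S}f(z)|$, and likewise for $\|\mathcal{S}h\|$. *)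

(* Defs.v *)
From Stdlib Require Export Reals.
From Coquelicot Require Export Coquelicot.

Open Scope R_scope.

Definition Disk (z : C) : Prop := Cmod z < 1.

(* Functions on the disk are total functions C -> C of which only the values
   on the disk matter; since the disk is open, so do the (local) derivatives
   [C_derive] and [Derive] at its points. *)
Definition analytic (f : C -> C) : Prop :=
  forall z : C, Disk z -> @ex_derive C_AbsRing C_NormedModule f z.

Definition univalent (f : C -> C) : Prop :=
  analytic f /\
  forall z w : C, Disk z -> Disk w -> f z = f w -> z = w.

Definition partial_x (F : C -> C) (z : C) : C :=
  (Derive (fun t : R => Re (F (t, Im z))) (Re z),
   Derive (fun t : R => Im (F (t, Im z))) (Re z)).

Definition partial_y (F : C -> C) (z : C) : C :=
  (Derive (fun t : R => Re (F (Re z, t))) (Im z),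
   Derive (fun t : R => Im (F (Re z, t))) (Im z)).

Definition wirtinger (F : C -> C) (z : C) : C :=
  (/ 2 * (partial_x F z - Ci * partial_y F z))%C.

(* A harmonic mapping f = h + conj g of the disk, given with its analytic
   part h and its co-analytic part g. *)
Record harmonic_mapping : Type := HarmonicMapping {
  hpart : C -> C;
  gpart : C -> C;
  hpart_analytic : analytic hpart;
  gpart_analytic : analytic gpart
}.

Definition harmonic_fun (f : harmonic_mapping) (z : C) : C :=
  (hpart f z + Cconj (gpart f z))%C.

Coercion harmonic_fun : harmonic_mapping >-> Funclass.

(* Stated as positivity of the Jacobian |h'|^2 - |g'|^2 of f on the disk. *)
Definition locally_univalent_orientation_preserving
    (f : harmonic_mapping) : Prop :=
  forall z : C, Disk z ->
    Cmod (C_derive (gpart f) z) < Cmod (C_derive (hpart f) z).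

Definition dilatation (f : harmonic_mapping) (z : C) : C :=
  (C_derive (gpart f) z / C_derive (hpart f) z)%C.

Definition log_metric (f : harmonic_mapping) (z : C) : R :=
  ln (Cmod (C_derive (hpart f) z) + Cmod (C_derive (gpart f) z)).

Definition harmonic_schwarzian (f : harmonic_mapping) (z : C) : C :=
  let sigma_z := wirtinger (fun w : C => RtoC (log_metric f w)) in
  (2 * (wirtinger sigma_z z - sigma_z z ^ 2))%C.

Definition schwarzian (h : C -> C) (z : C) : C :=
  let pre (w : C) : C := (C_derive (C_derive h) w / C_derive h w)%C in
  (C_derive pre z - / 2 * pre z ^ 2)%C.

Definition schwarzian_norm (S : C -> C) : Rbar :=
  Lub_Rbar (fun r : R => exists z : C,
    Disk z /\ r = (1 - Cmod z ^ 2) ^ 2 * Cmod (S z)).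

(* Main.v *)
Require Import Defs.
From Stdlib Require Import Lra Lia Psatz ClassicalEpsilon.

(** Write P = h''/h' for the pre-Schwarzian of h and d(z) = 1 - |z|.  The
    whole statement turns on one quantity, the supremum of |P| d over the disk:
    each of the two norms is finite exactly when this supremum is.

    _The formula._  Since the dilatation is q^2, |h'| + |g'| = |h'| (1 + |q|^2).
    Hence sigma_z = P/2 + q' conj(q) / (1 + |q|^2), and differentiating once more,
    S f = S h + 2 conj(q)/(1+|q|^2) (q'' - q' P) - 4 (q' conj(q)/(1+|q|^2))^2
    ([harmonic_schwarzian_formula]).  As |q| < 1, Cauchy's estimates bound q' by
    2/d and q'' by 16/d^2, so S f - S h is O(1/d^2 + |P|/d)
    ([schwarzian_difference_bound]).

    _From P to the norms._  If |P| d is bounded then P' = O(1/d^2), again by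
    Cauchy's estimates, so S h = P' - P^2/2 is O(1/d^2), and so is S f.

    _From the norms to P._  If S h or S f is O(1/d^2), then in both cases P
    satisfies |P' - P^2/2| <= K (1/d^2 + |P|/d).  The solution of w' = w^2/2 with
    w(0) = A > 0 blows up at time 2/A.  If |P| d were very large somewhere, one
    could pick a centre where |P| = A and a disc around it of radius much larger
    than 2/A on which |P| <= 2A ([point_picking]); along a radius of that disc P
    would follow the exploding solution closely enough for a contradiction
    ([riccati_bound]).

    _Univalent h._  If G is injective without zeros on a disc of radius R, then
    |G'/G| R is bounded at the centre: otherwise, by point picking, G would be
    nearly a multiple of exp(a z) on a disc containing a full period 2 pi i / a,
    and would take one value twice
    ([nonvanishing_injective_log_derivative]).  Applied to h - h(c) on discs that
    just avoid c, this bounds psi(z) = (h'(z) (z-c) / (h(z) - h(c)) - 1) / (z-c)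
    on a circle about c.  Since psi(c) = P(c)/2, the maximum principle bounds
    P(c) ([univalent_pre_schwarzian]).

    _Function theory._  Only complex differentiability is assumed of analytic
    functions.  Goursat's lemma, obtained by quartering rectangles, is applied to
    w |-> f (a + exp w) on rectangles of height 2 pi, where two opposite sides
    cancel by periodicity; letting the left side go to -oo compares f(a) with
    the values of f on a circle, and this needs only continuity of f at a
    ([circle_max]).  For the slope function of f at a this is Cauchy's estimate
    for f'(a); Cauchy's estimate for the difference quotients of f shows in turn
    that f' is complex differentiable ([holo_derive]). *)

Open Scope R_scope.

Local Notation CU := (AbsRing_UniformSpace C_AbsRing).

(** * Complex derivatives *)

Definition Ccont (f : C -> C) (z : C) : Prop :=
  @continuous CU CU f z.

Lemma Ccont_eps f z : Ccont f z <->
  forall e, 0 < e -> exists d, 0 < d /\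
    forall w, Cmod (w - z) < d -> Cmod (f w - f z) < e.
Proof.
split.
- intros H e He.
  destruct (proj1 (filterlim_locally _ _) H (mkposreal e He)) as [d Hd].
  exists d; split; [apply cond_pos|]. intros w Hw. exact (Hd w Hw).
- intros H. apply filterlim_locally. intros e.
  destruct (H e (cond_pos e)) as (d & Hd & Hw).
  exists (mkposreal d Hd). intros w Hw'. exact (Hw w Hw').
Qed.

Lemma Ccont_const c z : Ccont (fun _ => c) z.
Proof. exact (@continuous_const CU CU c z). Qed.
Lemma Ccont_id z : Ccont (fun w => w) z.
Proof. exact (@continuous_id CU z). Qed.
Lemma Ccont_plus f g z : Ccont f z -> Ccont g z -> Ccont (fun w => f w + g w)%C z.
Proof. intros Hf Hg. exact (@continuous_plus CU C_AbsRing (AbsRing_NormedModule C_AbsRing) f g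
  z Hf Hg). Qed.
Lemma Ccont_mult f g z : Ccont f z -> Ccont g z -> Ccont (fun w => f w * g w)%C z.
Proof. intros Hf Hg. exact (@continuous_mult CU C_AbsRing f g z Hf Hg). Qed.
Lemma Ccont_comp f g z : Ccont f z -> Ccont g (f z) -> Ccont (fun w => g (f w)) z.
Proof. intros Hf Hg. exact (@continuous_comp CU CU CU f g z Hf Hg). Qed.

Lemma Ccont_ext_loc f g z :
  (exists d, 0 < d /\ forall w, Cmod (w - z) < d -> f w = g w) -> Ccont f z -> Ccont g z.
Proof.
intros (d & Hd & E) H. apply Ccont_eps. intros e He.
destruct (proj1 (Ccont_eps f z) H e He) as (d' & Hd' & K).
exists (Rmin d d'); split; [now apply Rmin_glb_lt|].
intros w Hw. rewrite <- (E w), <- (E z).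
- apply K. eapply Rlt_le_trans; [exact Hw|apply Rmin_r].
- replace (z - z)%C with (RtoC 0) by ring. rewrite Cmod_0. exact Hd.
- eapply Rlt_le_trans; [exact Hw|apply Rmin_l].
Qed.

Lemma Cmod_minus_sym a b : Cmod (a - b) = Cmod (b - a).
Proof. rewrite <- Cmod_opp. f_equal. ring. Qed.

Lemma Cmod_triangle_rev a b : Cmod a - Cmod b <= Cmod (a - b).
Proof.
assert (H := Cmod_triangle (a - b) b).
replace (a - b + b)%C with a in H by ring. lra.
Qed.

Lemma Cmod_triangle_minus a b : Cmod (a - b) <= Cmod a + Cmod b.
Proof.
unfold Cminus. rewrite <- (Cmod_opp b). apply Cmod_triangle.
Qed.

Lemma Cminus_diag a : (a - a)%C = RtoC 0.
Proof. ring. Qed.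

Lemma Cminus_neq_0 a b : a <> b -> (a - b)%C <> RtoC 0.
Proof.
intros H E. apply H. replace a with (a - b + b)%C by ring. rewrite E. ring.
Qed.

Lemma Ccont_neq_0 f z : Ccont f z -> f z <> 0 ->
  exists d, 0 < d /\ forall w, Cmod (w - z) < d -> Cmod (f z) / 2 < Cmod (f w).
Proof.
intros H N. apply Cmod_gt_0 in N.
destruct (proj1 (Ccont_eps f z) H (Cmod (f z) / 2)) as (d & Hd & K); [lra|].
exists d; split; [exact Hd|]. intros w Hw. specialize (K w Hw).
assert (T := Cmod_triangle_rev (f z) (f w)). rewrite Cmod_minus_sym in T. lra.
Qed.

Lemma Ccont_inv f z : Ccont f z -> f z <> 0 -> Ccont (fun w => / f w)%C z.
Proof.
intros H N.
destruct (Ccont_neq_0 f z H N) as (d & Hd & K).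
apply Cmod_gt_0 in N as N'. set (m := Cmod (f z)) in *.
apply Ccont_eps. intros e He.
destruct (proj1 (Ccont_eps f z) H (e * (m * m / 2))) as (d' & Hd' & K').
{ apply Rmult_lt_0_compat; nra. }
exists (Rmin d d'); split; [now apply Rmin_glb_lt|].
intros w Hw.
assert (H1 := K w (Rlt_le_trans _ _ _ Hw (Rmin_l _ _))).
assert (H2 := K' w (Rlt_le_trans _ _ _ Hw (Rmin_r _ _))).
assert (Nw : f w <> 0) by (apply Cmod_gt_0; lra).
replace (/ f w - / f z)%C with ((f z - f w) / (f w * f z))%C by (field; auto).
rewrite Cmod_div, Cmod_mult by (apply Cmult_neq_0; auto).
fold m. rewrite Cmod_minus_sym.
apply (Rmult_lt_reg_r (Cmod (f w) * m)); [nra|].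
unfold Rdiv. rewrite Rmult_assoc, Rinv_l, Rmult_1_r by nra.
eapply Rlt_le_trans; [exact H2|]. apply Rmult_le_compat_l; [lra|]. nra.
Qed.

(** Caratheodory's form of the derivative: the slope function extends
    continuously to z.  The product, chain and quotient rules then reduce to
    continuity, and Cauchy's estimate is the maximum principle for the slope
    function. *)
Definition Cder (f : C -> C) (z l : C) : Prop :=
  exists phi, Ccont phi z /\ phi z = l /\ forall w, f w = (f z + phi w * (w - z))%C.

Lemma Cder_eps f z l : Cder f z l <->
  forall e, 0 < e -> exists d, 0 < d /\
    forall w, Cmod (w - z) < d -> Cmod (f w - f z - l * (w - z)) <= e * Cmod (w - z).
Proof.
split.
- intros (phi & Hc & Hz & E) e He.
  destruct (proj1 (Ccont_eps _ _) Hc e He) as (d & Hd & K).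
  exists d; split; [exact Hd|]. intros w Hw. rewrite (E w), <- Hz.
  replace (f z + phi w * (w - z) - f z - phi z * (w - z))%C
    with ((phi w - phi z) * (w - z))%C by ring.
  rewrite Cmod_mult. apply Rmult_le_compat_r; [apply Cmod_ge_0|]. left; auto.
- intros H.
  exists (fun w => if Ceq_dec w z then l else ((f w - f z) / (w - z))%C).
  assert (Hz : (if Ceq_dec z z then l else ((f z - f z) / (z - z))%C) = l)
    by (destruct (Ceq_dec z z); congruence).
  split; [|split]; [|exact Hz|].
  + apply Ccont_eps. rewrite Hz. intros e He.
    destruct (H (e / 2)) as (d & Hd & K); [lra|].
    exists d; split; [exact Hd|]. intros w Hw.
    destruct (Ceq_dec w z) as [->|N].
    * rewrite Cminus_diag, Cmod_0. exact He.
    * specialize (K w Hw). assert (N' := Cminus_neq_0 _ _ N).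
      replace ((f w - f z) / (w - z) - l)%C with ((f w - f z - l * (w - z)) / (w - z))%C
        by (field; auto).
      rewrite Cmod_div by auto. apply Cmod_gt_0 in N'.
      apply (Rmult_lt_reg_r (Cmod (w - z))); [lra|].
      unfold Rdiv. rewrite Rmult_assoc, Rinv_l by lra. nra.
  + intros w. destruct (Ceq_dec w z) as [->|N]; [ring|].
    field. now apply Cminus_neq_0.
Qed.

Lemma Cder_is_derive f z l : Cder f z l <-> @is_derive C_AbsRing C_NormedModule f z l.
Proof.
rewrite Cder_eps. split.
- intros H. split; [apply is_linear_scal_l|].
  intros x Hx. apply (@is_filter_lim_locally_unique C_AbsRing (AbsRing_NormedModule C_AbsRing))
    in Hx. subst x. intros e.
  destruct (H e (cond_pos e)) as (d & Hd & K).
  exists (mkposreal d Hd). intros w Hw. specialize (K w Hw).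
  change (Cmod (f w - f z - (w - z) * l) <= e * Cmod (w - z)).
  rewrite (Cmult_comm (w - z)). exact K.
- intros [_ H] e He.
  destruct (H z (fun P HP => HP) (mkposreal e He)) as (d & K).
  exists d; split; [apply cond_pos|]. intros w Hw. specialize (K w Hw).
  change (Cmod (f w - f z - (w - z) * l) <= e * Cmod (w - z)) in K.
  rewrite (Cmult_comm l). exact K.
Qed.

Lemma Cder_C_derive f z l : Cder f z l -> C_derive f z = l.
Proof. intros H. apply is_C_derive_unique. now apply Cder_is_derive. Qed.

Lemma Cder_cont f z l : Cder f z l -> Ccont f z.
Proof.
intros (phi & Hc & _ & E).
apply (Ccont_ext_loc (fun w => f z + phi w * (w + - z))%C).
- exists 1; split; [lra|]. intros w _. symmetry. apply E.
- apply Ccont_plus; [apply Ccont_const|]. apply Ccont_mult; [exact Hc|].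
  apply Ccont_plus; [apply Ccont_id|apply Ccont_const].
Qed.

Lemma Cder_ext_loc f g z l :
  (exists d, 0 < d /\ forall w, Cmod (w - z) < d -> f w = g w) -> Cder f z l -> Cder g z l.
Proof.
intros (d & Hd & E) H. apply Cder_eps. intros e He.
destruct (proj1 (Cder_eps f z l) H e He) as (d' & Hd' & K).
exists (Rmin d d'); split; [now apply Rmin_glb_lt|].
intros w Hw. rewrite <- (E w), <- (E z).
- apply K. eapply Rlt_le_trans; [exact Hw|apply Rmin_r].
- rewrite Cminus_diag, Cmod_0. exact Hd.
- eapply Rlt_le_trans; [exact Hw|apply Rmin_l].
Qed.

Lemma Cder_eq f z l l' : Cder f z l -> l = l' -> Cder f z l'.
Proof. intros H <-. exact H. Qed.

Lemma Cder_const c z : Cder (fun _ => c) z 0.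
Proof.
exists (fun _ => RtoC 0). split; [apply Ccont_const|]. split; [easy|]. intros; ring.
Qed.
Lemma Cder_id z : Cder (fun w => w) z 1.
Proof.
exists (fun _ => RtoC 1). split; [apply Ccont_const|]. split; [easy|]. intros; ring.
Qed.
Lemma Cder_plus f g z a b : Cder f z a -> Cder g z b -> Cder (fun w => f w + g w)%C z (a + b).
Proof.
intros (p & Hp & Ep & Fp) (q & Hq & Eq & Fq).
exists (fun w => p w + q w)%C. split; [now apply Ccont_plus|].
split; [congruence|]. intros w. rewrite (Fp w), (Fq w). ring.
Qed.
Lemma Cder_mult f g z a b : Cder f z a -> Cder g z b ->
  Cder (fun w => f w * g w)%C z (a * g z + f z * b).
Proof.
intros Hf Hg. assert (Cg := Cder_cont _ _ _ Hg).
destruct Hf as (p & Hp & Ep & Fp), Hg as (q & Hq & Eq & Fq).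
exists (fun w => p w * g w + f z * q w)%C. split; [|split].
- apply Ccont_plus; apply Ccont_mult; auto. apply Ccont_const.
- congruence.
- intros w. rewrite (Fp w), (Fq w). ring.
Qed.
Lemma Cder_scal c f z a : Cder f z a -> Cder (fun w => c * f w)%C z (c * a).
Proof.
intros H. eapply Cder_eq; [exact (Cder_mult _ _ _ _ _ (Cder_const c z) H)|]. cbv beta; ring.
Qed.
Lemma Cder_opp f z a : Cder f z a -> Cder (fun w => - f w)%C z (- a).
Proof.
intros H. apply (Cder_ext_loc (fun w => (-(1)) * f w)%C).
- exists 1; split; [lra|]. intros; ring.
- eapply Cder_eq; [apply Cder_scal, H|]. ring.
Qed.
Lemma Cder_minus f g z a b : Cder f z a -> Cder g z b -> Cder (fun w => f w - g w)%C z (a - b).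
Proof. intros Hf Hg. apply Cder_plus; [exact Hf|]. now apply Cder_opp. Qed.
Lemma Cder_comp f g z a b : Cder f z a -> Cder g (f z) b -> Cder (fun w => g (f w)) z (b * a).
Proof.
intros Hf Hg. assert (Cf := Cder_cont _ _ _ Hf).
destruct Hf as (p & Hp & Ep & Fp), Hg as (q & Hq & Eq & Fq).
exists (fun w => q (f w) * p w)%C. split; [|split].
- apply Ccont_mult; auto. now apply Ccont_comp.
- congruence.
- intros w. rewrite (Fq (f w)). f_equal. rewrite (Fp w) at 2. ring.
Qed.
Lemma Cder_inv f z a : Cder f z a -> f z <> 0 -> Cder (fun w => / f w)%C z (- a / (f z * f z)).
Proof.
intros Hf N. assert (Cf := Cder_cont _ _ _ Hf).
destruct (Ccont_neq_0 f z Cf N) as (d & Hd & K).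
assert (Nw : forall w, Cmod (w - z) < d -> f w <> 0).
{ intros w Hw. apply Cmod_gt_0. specialize (K w Hw). apply Cmod_gt_0 in N. lra. }
destruct Hf as (p & Hp & Ep & Fp).
apply (Cder_ext_loc (fun w => if Rlt_dec (Cmod (w - z)) d then / f w
   else / f z + (- p w / (f w * f z)) * (w - z))%C).
{ exists d; split; [exact Hd|]. intros w Hw. destruct (Rlt_dec (Cmod (w - z)) d); easy. }
exists (fun w => - p w * / (f w * f z))%C. split; [|split].
- apply Ccont_mult.
  + apply (Ccont_ext_loc (fun w => (-(1)) * p w)%C).
    * exists 1; split; [lra|]. intros; ring.
    * apply Ccont_mult; [apply Ccont_const|exact Hp].
  + apply Ccont_inv; [|now apply Cmult_neq_0]. apply Ccont_mult; [exact Cf|apply Ccont_const].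
- rewrite Ep. reflexivity.
- intros w. rewrite Cminus_diag, Cmod_0. destruct (Rlt_dec 0 d); [|easy].
  destruct (Rlt_dec (Cmod (w - z)) d) as [Hw|_]; [|reflexivity].
  assert (N' := Nw w Hw).
  replace (/ f z + - p w * / (f w * f z) * (w - z))%C
    with ((f w - p w * (w - z)) / (f w * f z))%C by (field; auto).
  rewrite (Fp w) at 2.
  replace (f z + p w * (w - z) - p w * (w - z))%C with (f z) by ring.
  field; auto.
Qed.
Lemma Cder_div f g z a b : Cder f z a -> Cder g z b -> g z <> 0 ->
  Cder (fun w => f w / g w)%C z ((a * g z - f z * b) / (g z * g z)).
Proof.
intros Hf Hg N.
eapply Cder_eq; [exact (Cder_mult _ _ _ _ _ Hf (Cder_inv _ _ _ Hg N))|].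
cbv beta. field. auto.
Qed.

(** * Derivatives of curves *)

Lemma is_derive_eps (f : R -> R) (x l : R) : is_derive f x l <->
  forall e, 0 < e -> exists d, 0 < d /\
    forall y, Rabs (y - x) < d -> Rabs (f y - f x - l * (y - x)) <= e * Rabs (y - x).
Proof.
split.
- intros [_ H] e He.
  destruct (H x (fun P HP => HP) (mkposreal e He)) as (d & K).
  exists d; split; [apply cond_pos|]. intros w Hw. specialize (K w Hw).
  change (Rabs (f w - f x - (w - x) * l) <= e * Rabs (w - x)) in K.
  rewrite (Rmult_comm l). exact K.
- intros H. split; [apply is_linear_scal_l|].
  intros x' Hx. apply (@is_filter_lim_locally_unique R_AbsRing (AbsRing_NormedModule
    R_AbsRing)) in Hx. subst x'. intros e.
  destruct (H e (cond_pos e)) as (d & Hd & K).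
  exists (mkposreal d Hd). intros w Hw. specialize (K w Hw).
  change (Rabs (f w - f x - (w - x) * l) <= e * Rabs (w - x)).
  rewrite (Rmult_comm (w - x)). exact K.
Qed.

(** Componentwise, so that the rules for real functions and the partial
    derivatives of the statement apply directly. *)
Definition Rder (g : R -> C) (t : R) (v : C) : Prop :=
  is_derive (fun s => fst (g s)) t (fst v) /\ is_derive (fun s => snd (g s)) t (snd v).

Lemma Cmod_le_abs z : Cmod z <= Rabs (fst z) + Rabs (snd z).
Proof.
destruct z as [a b]. cbn.
replace (a, b) with (RtoC a + Ci * RtoC b)%C by (unfold RtoC, Ci; apply injective_projections;
  cbn; ring).
eapply Rle_trans; [apply Cmod_triangle|]. rewrite Cmod_mult, Cmod_Ci, !Cmod_R. lra.
Qed.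
Lemma Rabs_fst_le_Cmod z : Rabs (fst z) <= Cmod z.
Proof. exact (re_le_Cmod z). Qed.
Lemma Rabs_snd_le_Cmod z : Rabs (snd z) <= Cmod z.
Proof. eapply Rle_trans; [apply Rmax_r|apply Rmax_Cmod]. Qed.

Lemma Rder_eps g t v : Rder g t v <->
  forall e, 0 < e -> exists d, 0 < d /\
    forall s, Rabs (s - t) < d -> Cmod (g s - g t - v * RtoC (s - t)) <= e * Rabs (s - t).
Proof.
unfold Rder. rewrite !is_derive_eps. split.
- intros [H1 H2] e He.
  destruct (H1 (e / 2)) as (d1 & Hd1 & K1); [lra|].
  destruct (H2 (e / 2)) as (d2 & Hd2 & K2); [lra|].
  exists (Rmin d1 d2); split; [now apply Rmin_glb_lt|]. intros s Hs.
  specialize (K1 s (Rlt_le_trans _ _ _ Hs (Rmin_l _ _))).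
  specialize (K2 s (Rlt_le_trans _ _ _ Hs (Rmin_r _ _))).
  eapply Rle_trans; [apply Cmod_le_abs|]. cbn.
  replace (fst (g s) + - fst (g t) + - (fst v * (s - t) - snd v * 0))
    with (fst (g s) - fst (g t) - fst v * (s - t)) by ring.
  replace (snd (g s) + - snd (g t) + - (fst v * 0 + snd v * (s - t)))
    with (snd (g s) - snd (g t) - snd v * (s - t)) by ring.
  lra.
- intros H. split; intros e He; destruct (H e He) as (d & Hd & K); exists d; split; auto;
  intros s Hs; specialize (K s Hs); eapply Rle_trans; try exact K.
  + eapply Rle_trans; [|apply Rabs_fst_le_Cmod]. right. f_equal. cbn. ring.
  + eapply Rle_trans; [|apply Rabs_snd_le_Cmod]. right. f_equal. cbn. ring.
Qed.

Lemma Rder_comp F g t l v : Cder F (g t) l -> Rder g t v -> Rder (fun s => F (g s)) t (l * v).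
Proof.
rewrite Cder_eps, !Rder_eps. intros HF Hg e He.
assert (P1 := Cmod_ge_0 v). assert (P2 := Cmod_ge_0 l).
destruct (HF (e / (2 * (Cmod v + 1)))) as (d1 & Hd1 & K1).
{ apply Rdiv_lt_0_compat; lra. }
destruct (Hg (Rmin 1 (e / (2 * (Cmod l + 1))))) as (d2 & Hd2 & K2).
{ apply Rmin_glb_lt; [lra|]. apply Rdiv_lt_0_compat; lra. }
exists (Rmin d2 (d1 / (Cmod v + 1))); split.
{ apply Rmin_glb_lt; [lra|]. apply Rdiv_lt_0_compat; lra. }
intros s Hs.
specialize (K2 s (Rlt_le_trans _ _ _ Hs (Rmin_l _ _))).
assert (Hs2 := Rlt_le_trans _ _ _ Hs (Rmin_r _ _)).
assert (P3 := Rabs_pos (s - t)).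
assert (B : Cmod (g s - g t) <= (Cmod v + 1) * Rabs (s - t)).
{ replace (g s - g t)%C with ((g s - g t - v * RtoC (s - t)) + v * RtoC (s - t))%C by ring.
  eapply Rle_trans; [apply Cmod_triangle|]. rewrite (Cmod_mult v), Cmod_R.
  assert (Rmin 1 (e / (2 * (Cmod l + 1))) <= 1) by apply Rmin_l. nra. }
assert (B' : Cmod (g s - g t) < d1).
{ eapply Rle_lt_trans; [exact B|]. apply (Rmult_lt_compat_l (Cmod v + 1)) in Hs2; [|lra].
  replace ((Cmod v + 1) * (d1 / (Cmod v + 1))) with d1 in Hs2 by (field; lra). exact Hs2. }
specialize (K1 (g s) B').
replace (F (g s) - F (g t) - l * v * RtoC (s - t))%C
 with ((F (g s) - F (g t) - l * (g s - g t)) + l * (g s - g t - v * RtoC (s - t)))%C by ring.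
eapply Rle_trans; [apply Cmod_triangle|]. rewrite (Cmod_mult l).
assert (Q1 : e / (2 * (Cmod v + 1)) * Cmod (g s - g t) <= e / 2 * Rabs (s - t)).
{ replace (e / 2 * Rabs (s - t)) with (e / (2 * (Cmod v + 1)) * ((Cmod v + 1) * Rabs (s - t)))
    by (field; lra).
  apply Rmult_le_compat_l; [|exact B]. left; apply Rdiv_lt_0_compat; lra. }
assert (Q2 : Cmod l * Cmod (g s - g t - v * RtoC (s - t)) <= e / 2 * Rabs (s - t)).
{ assert (Rmin 1 (e / (2 * (Cmod l + 1))) <= e / (2 * (Cmod l + 1))) by apply Rmin_r.
  assert (Cmod (g s - g t - v * RtoC (s - t)) <= e / (2 * (Cmod l + 1)) * Rabs (s - t)) by nra.
  assert (0 <= Cmod (g s - g t - v * RtoC (s - t))) by apply Cmod_ge_0.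
  apply Rle_trans with ((Cmod l + 1) * (e / (2 * (Cmod l + 1)) * Rabs (s - t))).
  - nra.
  - right. field. lra. }
lra.
Qed.

Lemma Rder_eq g t v v' : Rder g t v -> v = v' -> Rder g t v'.
Proof. intros H <-; exact H. Qed.

Lemma Rder_ext g h t v : (forall s, g s = h s) -> Rder g t v -> Rder h t v.
Proof.
intros E [H1 H2]. split; [eapply is_derive_ext; [|exact H1]|eapply is_derive_ext; [|exact H2]];
intros s; cbv beta; now rewrite (E s).
Qed.

Lemma Rder_plus f g t a b : Rder f t a -> Rder g t b -> Rder (fun s => f s + g s)%C t (a + b).
Proof.
intros [A1 A2] [B1 B2]. split; cbn.
- apply (is_derive_plus (fun s => fst (f s)) (fun s => fst (g s))); assumption.
- apply (is_derive_plus (fun s => snd (f s)) (fun s => snd (g s))); assumption.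
Qed.

Lemma Rder_mult f g t a b : Rder f t a -> Rder g t b ->
  Rder (fun s => f s * g s)%C t (a * g t + f t * b).
Proof.
intros [A1 A2] [B1 B2]. split; cbn.
- replace (fst a * fst (g t) - snd a * snd (g t) + (fst (f t) * fst b - snd (f t) * snd b)) with
  ((fst a * fst (g t) + fst (f t) * fst b) - (snd a * snd (g t) + snd (f t) * snd b)) by ring.
  apply (is_derive_minus (fun s => fst (f s) * fst (g s)) (fun s => snd (f s) * snd (g s)));
  now apply Derive.is_derive_mult.
- replace (fst a * snd (g t) + snd a * fst (g t) + (fst (f t) * snd b + snd (f t) * fst b)) with
  ((fst a * snd (g t) + fst (f t) * snd b) + (snd a * fst (g t) + snd (f t) * fst b)) by ring.
  apply (is_derive_plus (fun s => fst (f s) * snd (g s)) (fun s => snd (f s) * fst (g s)));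
  now apply Derive.is_derive_mult.
Qed.

Lemma Rder_const c t : Rder (fun _ => c) t 0.
Proof. split; cbn; apply @is_derive_const. Qed.

Lemma Rder_line a u t : Rder (fun s => a + RtoC s * u)%C t u.
Proof.
split; cbn; auto_derive; auto; ring.
Qed.

Lemma Rder_conj f t a : Rder f t a -> Rder (fun s => Cconj (f s)) t (Cconj a).
Proof.
intros [H1 H2]. split; cbn; [exact H1|].
apply (is_derive_opp (fun s => snd (f s))). exact H2.
Qed.

(** * Goursat's lemma *)

(** Cousin's principle in the plane.  A rectangle violating P has a quarter
    violating P; the nested violators shrink to a point, where the local
    hypothesis is contradicted.  It is used for Goursat's lemma and for the
    boundedness of continuous functions on closed discs. *)
Lemma rectangle_induction (P : R -> R -> R -> R -> Prop) x0 y0 p0 q0 :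
  0 <= p0 -> 0 <= q0 ->
  (forall x y p q, 0 <= p -> 0 <= q ->
     x0 <= x -> x + p <= x0 + p0 -> y0 <= y -> y + q <= y0 + q0 ->
     P x y (p/2) (q/2) -> P (x + p/2) y (p/2) (q/2) ->
     P x (y + q/2) (p/2) (q/2) -> P (x + p/2) (y + q/2) (p/2) (q/2) -> P x y p q) ->
  (forall X Y, x0 <= X <= x0 + p0 -> y0 <= Y <= y0 + q0 -> exists d, 0 < d /\
     forall x y p q, 0 <= p < d -> 0 <= q < d -> x <= X <= x + p -> y <= Y <= y + q ->
     x0 <= x -> x + p <= x0 + p0 -> y0 <= y -> y + q <= y0 + q0 -> P x y p q) ->
  P x0 y0 p0 q0.
Proof.
intros Hp0 Hq0 Hstep Hloc. apply NNPP; intros Hn.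
set (pn := fun n => p0 / 2 ^ n). set (qn := fun n => q0 / 2 ^ n).
assert (P2 : forall n, 0 < 2 ^ n) by (intros; apply pow_lt; lra).
assert (Pp : forall n, 0 <= pn n).
{ intros n. unfold pn, Rdiv. apply Rmult_le_pos; [lra|]. left; apply Rinv_0_lt_compat, P2. }
assert (Pq : forall n, 0 <= qn n).
{ intros n. unfold qn, Rdiv. apply Rmult_le_pos; [lra|]. left; apply Rinv_0_lt_compat, P2. }
assert (Sp : forall n, pn n / 2 = pn (S n)).
{ intros n. unfold pn. simpl. field. specialize (P2 n). lra. }
assert (Sq : forall n, qn n / 2 = qn (S n)).
{ intros n. unfold qn. simpl. field. specialize (P2 n). lra. }
(* The lower left corner of a quarter that violates P, if there is one. *)
set (next := fun n (z : R * R) => let (x, y) := z in let p := pn (S n) in let q := qn (S n) in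
  if excluded_middle_informative (P x y p q) then
  if excluded_middle_informative (P (x + p) y p q) then
  if excluded_middle_informative (P x (y + q) p q) then (x + p, y + q)
  else (x, y + q) else (x + p, y) else (x, y)).
set (s := fix s n := match n with O => (x0, y0) | S m => next m (s m) end).
assert (Inv : forall n, x0 <= fst (s n) /\ fst (s n) + pn n <= x0 + p0 /\
   y0 <= snd (s n) /\ snd (s n) + qn n <= y0 + q0 /\ ~ P (fst (s n)) (snd (s n)) (pn n) (qn n)
   /\ fst (s n) <= fst (s (S n)) /\ fst (s (S n)) + pn (S n) <= fst (s n) + pn n
   /\ snd (s n) <= snd (s (S n)) /\ snd (s (S n)) + qn (S n) <= snd (s n) + qn n).
{ assert (Mono : forall n, fst (s n) <= fst (s (S n)) /\ fst (s (S n)) + pn (S n) <= fst (s n)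
    + pn n
   /\ snd (s n) <= snd (s (S n)) /\ snd (s (S n)) + qn (S n) <= snd (s n) + qn n).
  { intros n. simpl. unfold next. destruct (s n) as [x y].
    specialize (Pp (S n)). specialize (Pq (S n)). rewrite <- (Sp n), <- (Sq n) in *.
    repeat destruct excluded_middle_informative; cbn; lra. }
  induction n as [|n IH].
  - cbn [s fst snd]. specialize (Mono 0%nat). cbn [s fst snd] in Mono.
    assert (E1 : pn 0%nat = p0) by (unfold pn; simpl; field).
    assert (E2 : qn 0%nat = q0) by (unfold qn; simpl; field).
    rewrite E1, E2 in *. repeat split; try lra; try exact Hn; apply Mono.
  - destruct IH as (A1 & A2 & A3 & A4 & A5 & A6 & A7 & A8 & A9).
    repeat split; try lra; try apply (Mono (S n)).
    simpl. unfold next. destruct (s n) as [x y]. cbn in A1, A2, A3, A4, A5.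
    repeat destruct excluded_middle_informative; cbn; try assumption.
    intros K. apply A5. apply Hstep; auto; rewrite (Sp n), (Sq n); assumption. }
assert (MX : forall n k, fst (s n) <= fst (s (n + k)%nat) /\ fst (s (n + k)%nat) + pn (n +
  k)%nat <= fst (s n) + pn n
   /\ snd (s n) <= snd (s (n + k)%nat) /\ snd (s (n + k)%nat) + qn (n + k)%nat <= snd (s n) +
     qn n).
{ intros n k. induction k as [|k IH].
  - rewrite Nat.add_0_r. lra.
  - rewrite Nat.add_succ_r. destruct (Inv (n + k)%nat) as (_ & _ & _ & _ & _ & A). lra. }
assert (BX : forall n m, fst (s n) <= fst (s m) + pn m /\ snd (s n) <= snd (s m) + qn m).
{ intros n m. destruct (Nat.le_ge_cases n m) as [L|L].
  - destruct (MX n (m - n)%nat) as (A & _ & B & _). replace (n + (m - n))%nat with m in * by lia.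
    specialize (Pp m). specialize (Pq m). lra.
  - destruct (MX m (n - m)%nat) as (_ & A & _ & B). replace (m + (n - m))%nat with n in * by lia.
    specialize (Pp n). specialize (Pq n). lra. }
destruct (completeness (fun r => exists n, r = fst (s n))) as [X [X1 X2]].
{ exists (fst (s 0%nat) + pn 0%nat). intros r [n ->]. apply BX. }
{ exists (fst (s 0%nat)). now exists 0%nat. }
destruct (completeness (fun r => exists n, r = snd (s n))) as [Y [Y1 Y2]].
{ exists (snd (s 0%nat) + qn 0%nat). intros r [n ->]. apply BX. }
{ exists (snd (s 0%nat)). now exists 0%nat. }
assert (LX : forall n, fst (s n) <= X <= fst (s n) + pn n).
{ intros n. split; [apply X1; now exists n|]. apply X2. intros r [m ->]. apply BX. }
assert (LY : forall n, snd (s n) <= Y <= snd (s n) + qn n).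
{ intros n. split; [apply Y1; now exists n|]. apply Y2. intros r [m ->]. apply BX. }
destruct (Hloc X Y) as (d & Hd & K).
{ specialize (LX 0%nat). destruct (Inv 0%nat). lra. }
{ specialize (LY 0%nat). destruct (Inv 0%nat). lra. }
assert (exists n, (p0 + q0) / d < 2 ^ n) as [n Hn'].
{ destruct (Pow_x_infinity 2 ltac:(rewrite Rabs_pos_eq; lra) ((p0 + q0) / d + 1)) as [n Hn'].
  exists n. specialize (Hn' n (le_n _)). rewrite Rabs_pos_eq in Hn' by (left; apply P2). lra. }
apply (Rmult_lt_compat_r d) in Hn'; [|lra]. unfold Rdiv in Hn'.
rewrite Rmult_assoc, Rinv_l in Hn' by lra.
destruct (Inv n) as (A1 & A2 & A3 & A4 & A5 & _).
apply A5. specialize (P2 n). apply K; auto; split; auto.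
- unfold pn. apply (Rmult_lt_reg_r (2 ^ n)); [easy|]. unfold Rdiv.
  rewrite Rmult_assoc, Rinv_l; lra.
- unfold qn. apply (Rmult_lt_reg_r (2 ^ n)); [easy|]. unfold Rdiv.
  rewrite Rmult_assoc, Rinv_l; lra.
Qed.

Definition horizontal_integral (f : C -> C) (y x p : R) : R := RInt (fun t => snd (f (t, y))) x
  (x + p).
Definition vertical_integral (f : C -> C) (x y q : R) : R := RInt (fun t => fst (f (x, t))) y
  (y + q).
(** The imaginary part of the integral of f dz around the rectangle with
    corner (x, y) and sides p, q; equivalently the flux of the field (Re f, - Im f)
    through its boundary. *)
Definition flux (f : C -> C) (x y p q : R) : R :=
  horizontal_integral f y x p - horizontal_integral f (y + q) x p
    + vertical_integral f (x + p) y q - vertical_integral f x y q.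

Lemma Rder_continuous g t v : Rder g t v ->
  continuous (fun s => fst (g s)) t /\ continuous (fun s => snd (g s)) t.
Proof.
intros [H1 H2]; split; [apply (ex_derive_continuous (fun s => fst (g s)))|apply
  (ex_derive_continuous (fun s => snd (g s)))]; eexists; eassumption.
Qed.

Lemma Rder_hline y t : Rder (fun s => (s, y)) t 1.
Proof. split; cbn; auto_derive; auto. Qed.
Lemma Rder_vline x t : Rder (fun s => (x, s)) t Ci.
Proof. split; cbn; auto_derive; auto. Qed.

Lemma Cder_h_continuous f x y l : Cder f (x, y) l ->
  continuous (fun s => snd (f (s, y))) x.
Proof.
intros H. exact (proj2 (Rder_continuous _ _ _ (Rder_comp f (fun s => (s, y)) x l 1 H
  (Rder_hline y x)))).
Qed.
Lemma Cder_v_continuous f x y l : Cder f (x, y) l ->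
  continuous (fun s => fst (f (x, s))) y.
Proof.
intros H. exact (proj1 (Rder_continuous _ _ _ (Rder_comp f (fun s => (x, s)) y l Ci H
  (Rder_vline x y)))).
Qed.

(** The bound 2 e (p + q)^2 is stable under quartering because the flux is
    additive.  Near a point of differentiability it holds because an affine map
    with the Cauchy-Riemann symmetry has no flux, and the remainder is at most
    e (p + q) on a boundary of length 2 (p + q). *)
Lemma goursat f x0 y0 p0 q0 : 0 <= p0 -> 0 <= q0 ->
  (forall x y, x0 <= x <= x0 + p0 -> y0 <= y <= y0 + q0 -> exists l, Cder f (x, y) l) ->
  flux f x0 y0 p0 q0 = 0.
Proof.
intros Hp0 Hq0 Hd.
assert (EH : forall y a b, y0 <= y <= y0 + q0 -> x0 <= a -> a <= b -> b <= x0 + p0 ->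
   ex_RInt (fun t => snd (f (t, y))) a b).
{ intros y a b Hy H1 H2 H3. apply (ex_RInt_continuous (V := R_CompleteNormedModule)).
  rewrite Rmin_left, Rmax_right by lra. intros t Ht.
  destruct (Hd t y) as [l Hl]; try lra. eapply Cder_h_continuous; eassumption. }
assert (EV : forall x a b, x0 <= x <= x0 + p0 -> y0 <= a -> a <= b -> b <= y0 + q0 ->
   ex_RInt (fun t => fst (f (x, t))) a b).
{ intros y a b Hy H1 H2 H3. apply (ex_RInt_continuous (V := R_CompleteNormedModule)).
  rewrite Rmin_left, Rmax_right by lra. intros t Ht.
  destruct (Hd y t) as [l Hl]; try lra. eapply Cder_v_continuous; eassumption. }
assert (SH : forall y x p, y0 <= y <= y0 + q0 -> x0 <= x -> 0 <= p -> x + p <= x0 + p0 ->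
  horizontal_integral f y x p = horizontal_integral f y x (p/2) + horizontal_integral f y (x +
    p/2) (p/2)).
{ intros y x p H1 H2 H3 H4. unfold horizontal_integral. symmetry.
  replace (x + p / 2 + p / 2) with (x + p) by field.
  apply (RInt_Chasles (V := R_CompleteNormedModule)); apply EH; lra. }
assert (SV : forall x y q, x0 <= x <= x0 + p0 -> y0 <= y -> 0 <= q -> y + q <= y0 + q0 ->
  vertical_integral f x y q = vertical_integral f x y (q/2) + vertical_integral f x (y + q/2)
    (q/2)).
{ intros x y q H1 H2 H3 H4. unfold vertical_integral. symmetry.
  replace (y + q / 2 + q / 2) with (y + q) by field.
  apply (RInt_Chasles (V := R_CompleteNormedModule)); apply EV; lra. }
assert (Main : forall e, 0 < e -> Rabs (flux f x0 y0 p0 q0) <= 2 * e * (p0 + q0) ^ 2).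
{ intros e He.
  apply (rectangle_induction (fun x y p q => Rabs (flux f x y p q) <= 2 * e * (p + q) ^ 2)); auto.
  - intros x y p q Hp Hq H1 H2 H3 H4 A B C D.
    replace (flux f x y p q) with (flux f x y (p/2) (q/2) + flux f (x + p/2) y (p/2) (q/2)
      + flux f x (y + q/2) (p/2) (q/2) + flux f (x + p/2) (y + q/2) (p/2) (q/2)).
    + eapply Rle_trans; [apply Rabs_triang|].
      eapply Rle_trans; [apply Rplus_le_compat_r, Rabs_triang|].
      eapply Rle_trans; [apply Rplus_le_compat_r, Rplus_le_compat_r, Rabs_triang|].
      replace (2 * e * (p + q) ^ 2) with (4 * (2 * e * (p / 2 + q / 2) ^ 2)) by field. lra.
    + unfold flux. rewrite (SH y x p), (SH (y + q) x p), (SV (x + p) y q), (SV x y q) by lra.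
      replace (x + p / 2 + p / 2) with (x + p) by field.
      replace (y + q / 2 + q / 2) with (y + q) by field. ring.
  - intros X Y HX HY. destruct (Hd X Y HX HY) as [l Hl].
    destruct (proj1 (Cder_eps _ _ _) Hl e He) as (d & Hd0 & K).
    exists (d / 2); split; [lra|]. intros x y p q Hp Hq HX' HY' H1 H2 H3 H4.
    assert (B : forall a b, x <= a <= x + p -> y <= b <= y + q ->
      Cmod (f (a, b) - f (X, Y) - l * ((a, b) - (X, Y))) <= e * (p + q)).
    { intros a b Ha Hb.
      assert (Q : Cmod ((a, b) - (X, Y)) <= p + q).
      { eapply Rle_trans; [apply Cmod_le_abs|]. cbn.
        apply Rplus_le_compat; apply Rabs_le; lra. }
      eapply Rle_trans; [apply K; lra|]. apply Rmult_le_compat_l; lra. }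
    assert (I1 : Rabs (horizontal_integral f y x p - horizontal_integral f (y + q) x p + fst l
      * p * q) <= 2 * e * (p + q) * p).
    { replace (horizontal_integral f y x p - horizontal_integral f (y + q) x p + fst l * p * q)
        with
        (RInt (fun t => snd (f (t, y)) - snd (f (t, y + q)) + fst l * q) x (x + p)).
      - replace (2 * e * (p + q) * p) with ((x + p - x) * (2 * e * (p + q))) by ring.
        apply abs_RInt_le_const; [lra| |].
        + apply (ex_RInt_plus (V := R_NormedModule) (fun t => snd (f (t, y)) - snd (f (t, y +
            q)))); [|apply ex_RInt_const].
          apply (ex_RInt_minus (V := R_NormedModule) (fun t => snd (f (t, y))) (fun t => snd (f
            (t, y + q)))); apply EH; lra.
        + intros t Ht. assert (A1 := B t y Ht ltac:(lra)).
          assert (A2 := B t (y + q) Ht ltac:(lra)).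
          assert (A1' := Rle_trans _ _ _ (Rabs_snd_le_Cmod _) A1).
          assert (A2' := Rle_trans _ _ _ (Rabs_snd_le_Cmod _) A2).
          cbn in A1', A2'. apply Rabs_le_between in A1'. apply Rabs_le_between in A2'.
          apply Rabs_le. nra.
      - unfold horizontal_integral. rewrite (RInt_plus (V := R_CompleteNormedModule) (fun t =>
          snd (f (t, y)) - snd (f (t, y + q)))).
        rewrite (RInt_minus (V := R_CompleteNormedModule) (fun t => snd (f (t, y))) (fun t =>
          snd (f (t, y + q)))).
        rewrite RInt_const. unfold plus, minus, opp, scal; cbn. unfold mult; cbn.
        unfold opp, plus; cbn. ring.
        apply EH; lra. apply EH; lra.
        apply (ex_RInt_minus (V := R_NormedModule) (fun t => snd (f (t, y))) (fun t => snd (f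
          (t, y + q)))); apply EH; lra.
        apply ex_RInt_const. }
    assert (I2 : Rabs (vertical_integral f (x + p) y q - vertical_integral f x y q - fst l * p
      * q) <= 2 * e * (p + q) * q).
    { replace (vertical_integral f (x + p) y q - vertical_integral f x y q - fst l * p * q) with
        (RInt (fun t => fst (f (x + p, t)) - fst (f (x, t)) - fst l * p) y (y + q)).
      - replace (2 * e * (p + q) * q) with ((y + q - y) * (2 * e * (p + q))) by ring.
        apply abs_RInt_le_const; [lra| |].
        + apply (ex_RInt_minus (V := R_NormedModule) (fun t => fst (f (x + p, t)) - fst (f (x,
            t)))); [|apply ex_RInt_const].
          apply (ex_RInt_minus (V := R_NormedModule) (fun t => fst (f (x + p, t))) (fun t =>
            fst (f (x, t)))); apply EV; lra.
        + intros t Ht. assert (A1 := B (x + p) t ltac:(lra) Ht).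
          assert (A2 := B x t ltac:(lra) Ht).
          assert (A1' := Rle_trans _ _ _ (Rabs_fst_le_Cmod _) A1).
          assert (A2' := Rle_trans _ _ _ (Rabs_fst_le_Cmod _) A2).
          cbn in A1', A2'. apply Rabs_le_between in A1'. apply Rabs_le_between in A2'.
          apply Rabs_le. nra.
      - unfold vertical_integral. rewrite (RInt_minus (V := R_CompleteNormedModule) (fun t =>
          fst (f (x + p, t)) - fst (f (x, t)))).
        rewrite (RInt_minus (V := R_CompleteNormedModule) (fun t => fst (f (x + p, t))) (fun t
          => fst (f (x, t)))).
        rewrite RInt_const. unfold plus, minus, opp, scal; cbn. unfold mult; cbn.
        unfold opp, plus; cbn. ring.
        apply EV; lra. apply EV; lra.
        apply (ex_RInt_minus (V := R_NormedModule) (fun t => fst (f (x + p, t))) (fun t => fst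
          (f (x, t)))); apply EV; lra.
        apply ex_RInt_const. }
    unfold flux.
    replace (horizontal_integral f y x p - horizontal_integral f (y + q) x p +
      vertical_integral f (x + p) y q - vertical_integral f x y q) with
     ((horizontal_integral f y x p - horizontal_integral f (y + q) x p + fst l * p * q) +
       (vertical_integral f (x + p) y q - vertical_integral f x y q - fst l * p * q)) by ring.
    eapply Rle_trans; [apply Rabs_triang|].
    replace (2 * e * (p + q) ^ 2) with (2 * e * (p + q) * p + 2 * e * (p + q) * q) by ring. lra. }
assert (Z : Rabs (flux f x0 y0 p0 q0) <= 0).
{ apply le_epsilon. intros e He. rewrite Rplus_0_l.
  set (m := 2 * (p0 + q0) ^ 2 + 1). assert (0 < m) by (unfold m; nra).
  eapply Rle_trans; [apply (Main (e / m)); now apply Rdiv_lt_0_compat|].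
  replace (2 * (e / m) * (p0 + q0) ^ 2) with (e * ((m - 1) / m)) by (unfold m; field; nra).
  rewrite <- (Rmult_1_r e) at 2. apply Rmult_le_compat_l; [lra|].
  apply (Rmult_le_reg_r m); [lra|]. unfold Rdiv. rewrite Rmult_assoc, Rinv_l; lra. }
assert (Z' := Rabs_pos (flux f x0 y0 p0 q0)).
destruct (Req_dec (flux f x0 y0 p0 q0) 0) as [|N]; [easy|]. apply Rabs_no_R0 in N. lra.
Qed.

Lemma fst_le_Cmod z : fst z <= Cmod z.
Proof. eapply Rle_trans; [apply Rle_abs|apply Rabs_fst_le_Cmod]. Qed.

Lemma Cmod_sqr z : Cmod z * Cmod z = fst z * fst z + snd z * snd z.
Proof. assert (H := Cmod2_alt z). unfold Re, Im in H. nra. Qed.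

(** * Mean value and Gronwall inequalities *)

(** The real mean value theorem for the projection of g on the direction
    u = g 1 - g 0. *)
Lemma Rder_mean_value g M :
  (forall t, 0 <= t <= 1 -> exists v, Rder g t v /\ Cmod v <= M) -> Cmod (g 1 - g 0) <= M.
Proof.
intros H. set (u := (g 1 - g 0)%C).
set (k := fun t => fst (Cconj u * g t)%C).
assert (D : forall t, 0 <= t <= 1 -> exists v, is_derive k t (fst (Cconj u * v)%C) /\ Cmod v <=
  M).
{ intros t Ht. destruct (H t Ht) as (v & Hv & B). exists v. split; [|exact B].
  destruct (Rder_eq _ _ _ (Cconj u * v)%C (Rder_mult _ _ _ _ _ (Rder_const (Cconj u) t) Hv)) as
    [A _]; [ring|].
  exact A. }
destruct (MVT_gen k 0 1 (Derive k)) as (c & Hc & E).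
- rewrite Rmin_left, Rmax_right by lra. intros x Hx. apply Derive_correct.
  destruct (D x) as (v & Hv & _); [lra|]. eexists; exact Hv.
- rewrite Rmin_left, Rmax_right by lra. intros x Hx. apply continuity_pt_filterlim.
  apply (ex_derive_continuous k). destruct (D x Hx) as (v & Hv & _). eexists; exact Hv.
- rewrite Rmin_left, Rmax_right in Hc by lra.
  destruct (D c Hc) as (v & Hv & B). rewrite (is_derive_unique _ _ _ Hv) in E.
  assert (E' : k 1 - k 0 = Cmod u * Cmod u).
  { rewrite Cmod_sqr. unfold k, u. cbn. ring. }
  rewrite E' in E. assert (B' := fst_le_Cmod (Cconj u * v)%C).
  rewrite Cmod_mult, Cmod_conj in B'. assert (P := Cmod_ge_0 u).
  destruct (Rle_lt_or_eq_dec 0 (Cmod u) P) as [L|L]; [|rewrite <- L; assert (Q := Cmod_ge_0 v);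
    lra].
  nra.
Qed.

Lemma is_derive_sqrt_exp (x y : R -> R) t x' y' c A b : is_derive x t x' -> is_derive y t y' ->
  0 < x t * x t + y t * y t + c ->
  is_derive (fun s => (sqrt (x s * x s + y s * y s + c) + b) * exp (- (A * s))) t
    (((x t * x' + y t * y') / sqrt (x t * x t + y t * y t + c)
       - A * (sqrt (x t * x t + y t * y t + c) + b)) * exp (- (A * t))).
Proof.
intros Hx Hy P. auto_derive.
- repeat split; auto; eexists; eassumption.
- rewrite (is_derive_unique (fun s : R => x s) _ _ Hx), (is_derive_unique (fun s : R => y s) _
    _ Hy).
  field. now apply Rgt_not_eq, sqrt_lt_R0.
Qed.

(** |g| need not be differentiable where g vanishes, so it is replaced by
    N = sqrt (|g|^2 + eta^2), which satisfies N' <= A N + B; then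
    (N + B/A) exp (- A t) decreases.  The parameter eta costs at most e in the
    conclusion. *)
Lemma gronwall (g : R -> C) T A B : 0 < A -> 0 <= B -> 0 <= T -> g 0 = 0 ->
  (forall t, 0 <= t <= T -> exists v, Rder g t v /\ Cmod v <= A * Cmod (g t) + B) ->
  Cmod (g T) <= B / A * (exp (A * T) - 1).
Proof.
intros HA HB HT H0 H.
apply le_epsilon. intros e He.
assert (PE := exp_pos (A * T)).
set (eta := e / exp (A * T)).
assert (Heta : 0 < eta) by now apply Rdiv_lt_0_compat.
set (N := fun t => sqrt (fst (g t) * fst (g t) + snd (g t) * snd (g t) + eta * eta)).
set (W := fun t => (N t + B / A) * exp (- (A * t))).
assert (NP : forall t, 0 < fst (g t) * fst (g t) + snd (g t) * snd (g t) + eta * eta) by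
  (intros; nra).
assert (NN : forall t, 0 < N t) by (intros; now apply sqrt_lt_R0).
assert (NS : forall t, N t * N t = Cmod (g t) * Cmod (g t) + eta * eta).
{ intros. unfold N. rewrite sqrt_sqrt by (left; apply NP). rewrite Cmod_sqr. ring. }
assert (NC : forall t, Cmod (g t) <= N t).
{ intros t. specialize (NS t). specialize (NN t). assert (P := Cmod_ge_0 (g t)). nra. }
assert (D : forall t, 0 <= t <= T -> exists w, is_derive W t w /\ w <= 0).
{ intros t Ht. destruct (H t Ht) as (v & [V1 V2] & Hv).
  exists (((fst (g t) * fst v + snd (g t) * snd v) / N t - A * (N t + B / A)) * exp (- (A * t))).
  split.
  - apply (is_derive_sqrt_exp (fun s => fst (g s)) (fun s => snd (g s))); auto.
  - assert (Q : fst (g t) * fst v + snd (g t) * snd v <= Cmod (g t) * Cmod v).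
    { assert (Q := fst_le_Cmod (Cconj (g t) * v)%C). rewrite Cmod_mult, Cmod_conj in Q.
      cbn in Q. lra. }
    assert (Q2 : (fst (g t) * fst v + snd (g t) * snd v) / N t <= A * (N t + B / A)).
    { apply (Rmult_le_reg_r (N t)); [apply NN|]. unfold Rdiv at 1.
      rewrite Rmult_assoc, Rinv_l, Rmult_1_r by (apply Rgt_not_eq, NN).
      replace (A * (N t + B / A)) with (A * N t + B) by (field; lra).
      specialize (NC t). specialize (NN t). assert (P1 := Cmod_ge_0 (g t)).
      assert (P2 := Cmod_ge_0 v).
      assert (Cmod v <= A * N t + B) by nra. nra. }
    assert (P := exp_pos (- (A * t))). nra. }
assert (WM : W T <= W 0).
{ destruct (MVT_gen W 0 T (Derive W)) as (c & Hc & E).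
  - rewrite Rmin_left, Rmax_right by lra. intros x Hx. apply Derive_correct.
    destruct (D x) as (v & Hv & _); [lra|]. eexists; exact Hv.
  - rewrite Rmin_left, Rmax_right by lra. intros x Hx. apply continuity_pt_filterlim.
    apply (ex_derive_continuous W). destruct (D x Hx) as (v & Hv & _). eexists; exact Hv.
  - rewrite Rmin_left, Rmax_right in Hc by lra. destruct (D c Hc) as (w & Hw & Hw').
    rewrite (is_derive_unique _ _ _ Hw) in E. nra. }
assert (E0 : W 0 = eta + B / A).
{ unfold W, N. rewrite H0. cbn. replace (- (A * 0)) with 0 by ring. rewrite exp_0.
  replace (0 * 0 + 0 * 0 + eta * eta) with (eta * eta) by ring. rewrite sqrt_square by lra. ring.
  }
rewrite E0 in WM. unfold W in WM. rewrite exp_Ropp in WM.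
apply (Rmult_le_compat_r (exp (A * T))) in WM; [|lra].
rewrite Rmult_assoc, Rinv_l, Rmult_1_r in WM by lra.
assert (Z : eta * exp (A * T) = e) by (unfold eta; field; lra).
specialize (NC T). nra.
Qed.

(** * The complex exponential *)

Definition Cexp (z : C) : C := (exp (fst z) * cos (snd z), exp (fst z) * sin (snd z)).

Lemma Cexp_0 : Cexp 0 = 1.
Proof. unfold Cexp. cbn. rewrite exp_0, cos_0, sin_0. unfold RtoC. f_equal; ring. Qed.
Lemma Cexp_plus z w : Cexp (z + w) = (Cexp z * Cexp w)%C.
Proof.
unfold Cexp. apply injective_projections; cbn; rewrite exp_plus; [rewrite cos_plus|rewrite
  sin_plus]; ring.
Qed.
Lemma Cmod_Cexp z : Cmod (Cexp z) = exp (fst z).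
Proof.
assert (P := exp_pos (fst z)).
assert (H := Cmod_sqr (Cexp z)). unfold Cexp in H at 3 4 5 6. cbn in H.
assert (S := sin2_cos2 (snd z)). unfold Rsqr in S.
assert (K : Cmod (Cexp z) * Cmod (Cexp z) = exp (fst z) * exp (fst z)).
{ rewrite H. replace (exp (fst z) * exp (fst z)) with (exp (fst z) * exp (fst z) * (sin (snd z)
    * sin (snd z) + cos (snd z) * cos (snd z))) by (rewrite S; ring). ring. }
assert (Q := Cmod_ge_0 (Cexp z)). nra.
Qed.

Lemma Cder_Cexp_0 : Cder Cexp 0 1.
Proof.
apply Cder_eps. intros e He. rewrite Cexp_0.
assert (D1 : is_derive exp 0 1) by (auto_derive; auto; rewrite exp_0; ring).
assert (D2 : Rder (fun s => (cos s, sin s)) 0 Ci).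
{ split; cbn; auto_derive; auto; rewrite ?sin_0, ?cos_0; ring. }
destruct (proj1 (is_derive_eps _ _ _) D1 (Rmin 1 (e / 4))) as (d1 & Hd1 & K1).
{ apply Rmin_glb_lt; lra. }
destruct (proj1 (Rder_eps _ _ _) D2 (e / 4)) as (d2 & Hd2 & K2); [lra|].
exists (Rmin (Rmin d1 d2) (Rmin (1/2) (e / 8))). split; [repeat apply Rmin_glb_lt; lra|].
intros w Hw. replace (w - 0)%C with w in * by ring.
assert (B1 := Rabs_fst_le_Cmod w). assert (B2 := Rabs_snd_le_Cmod w).
assert (L1 : Cmod w < d1). { eapply Rlt_le_trans; [exact Hw|].
eapply Rle_trans; [apply Rmin_l|apply Rmin_l]. }
assert (L2 : Cmod w < d2). { eapply Rlt_le_trans; [exact Hw|].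
eapply Rle_trans; [apply Rmin_l|apply Rmin_r]. }
assert (L3 : Cmod w < 1/2). { eapply Rlt_le_trans; [exact Hw|].
eapply Rle_trans; [apply Rmin_r|apply Rmin_l]. }
assert (L4 : Cmod w < e/8). { eapply Rlt_le_trans; [exact Hw|].
eapply Rle_trans; [apply Rmin_r|apply Rmin_r]. }
specialize (K1 (fst w)). specialize (K2 (snd w)). rewrite !Rminus_0_r, exp_0, ?Rmult_1_l in *.
rewrite cos_0, sin_0 in K2.
specialize (K1 ltac:(lra)). specialize (K2 ltac:(lra)).
assert (M1 := Rmin_l 1 (e / 4)). assert (M2 := Rmin_r 1 (e / 4)).
assert (PX := Rabs_pos (fst w)). assert (PY := Rabs_pos (snd w)).
set (c := (cos (snd w), sin (snd w))) in *.
(* With w = x + i y: first order remainder in x, first order remainder in y, mixed term. *)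
replace (Cexp w - 1 - 1 * w)%C with (RtoC (exp (fst w) - 1 - fst w)
   + RtoC (exp (fst w)) * (c - (1, 0) - Ci * RtoC (snd w)) + RtoC (exp (fst w) - 1) * (Ci *
       RtoC (snd w)))%C.
2:{ unfold c, Cexp. apply injective_projections; cbn; ring. }
assert (K1' : Rabs (exp (fst w) - 1 - fst w) <= e / 4 * Rabs (fst w)) by nra.
assert (K1'' : Rabs (exp (fst w) - 1) <= e / 4).
{ replace (exp (fst w) - 1) with ((exp (fst w) - 1 - fst w) + fst w) by ring.
  eapply Rle_trans; [apply Rabs_triang|]. nra. }
assert (K3 : Rabs (exp (fst w)) <= 2).
{ replace (exp (fst w)) with ((exp (fst w) - 1 - fst w) + fst w + 1) by ring.
  eapply Rle_trans; [apply Rabs_triang|].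
  eapply Rle_trans; [apply Rplus_le_compat_r, Rabs_triang|].
  rewrite Rabs_R1. nra. }
eapply Rle_trans; [apply Cmod_triangle|].
eapply Rle_trans; [apply Rplus_le_compat_r, Cmod_triangle|].
rewrite !Cmod_mult, Cmod_Ci, !Cmod_R.
assert (PC := Cmod_ge_0 (c - (1, 0) - Ci * RtoC (snd w))).
assert (PE1 := Rabs_pos (exp (fst w))). assert (PE2 := Rabs_pos (exp (fst w) - 1)).
assert (Q1 : Rabs (exp (fst w)) * Cmod (c - (1, 0) - Ci * RtoC (snd w)) <= 2 * (e / 4 * Rabs
  (snd w))) by nra.
assert (Q2 : Rabs (exp (fst w) - 1) * (1 * Rabs (snd w)) <= e / 4 * Rabs (snd w)) by nra.
nra.
Qed.

Lemma Cder_Cexp z : Cder Cexp z (Cexp z).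
Proof.
apply (Cder_ext_loc (fun w => Cexp z * Cexp (w - z))%C).
- exists 1; split; [lra|]. intros w _. rewrite <- Cexp_plus. f_equal. ring.
- eapply Cder_eq; [apply Cder_scal; apply (Cder_comp (fun w => w - z)%C Cexp z (1 - 0) 1)|ring].
  + apply Cder_minus; [apply Cder_id|apply Cder_const].
  + rewrite Cminus_diag. apply Cder_Cexp_0.
Qed.

(** * Mean values over circles *)

(** In the coordinate w = s + i t with z = a + exp w, Goursat's lemma on the
    rectangle s0 <= s <= s1, 0 <= t <= 2 pi says that the mean of Re f over the
    circle of radius exp s does not depend on s: the two horizontal sides cancel
    because exp has period 2 pi i.  Over small circles the mean is close to
    Re f(a), by continuity at a, which is all that slope functions offer at
    their centre. *)
Lemma circle_max_re f a R r M : 0 < r < R ->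
  (forall z, 0 < Cmod (z - a) < R -> exists l, Cder f z l) -> Ccont f a ->
  (forall z, Cmod (z - a) = r -> fst (f z) <= M) -> fst (f a) <= M.
Proof.
intros Hr Hd Hc HM. apply le_epsilon. intros e He.
destruct (proj1 (Ccont_eps _ _) Hc e He) as (d & Hd0 & K).
assert (Hm : 0 < Rmin r d / 2) by (assert (0 < Rmin r d) by (apply Rmin_glb_lt; lra); lra).
assert (Hm1 := Rmin_l r d). assert (Hm2 := Rmin_r r d).
set (s0 := ln (Rmin r d / 2)). set (s1 := ln r).
assert (Hs : s0 < s1) by (apply ln_increasing; lra).
assert (E0 : exp s0 = Rmin r d / 2) by (apply exp_ln; lra).
assert (E1 : exp s1 = r) by (apply exp_ln; lra).
assert (PI0 := PI_RGT_0).
set (g := fun w => f (a + Cexp w)%C).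
assert (Mod : forall w, Cmod (a + Cexp w - a) = exp (fst w)).
{ intros w. replace (a + Cexp w - a)%C with (Cexp w) by ring. apply Cmod_Cexp. }
assert (Hg : forall x y, x <= s1 -> exists l, Cder g (x, y) l).
{ intros x y Hx. destruct (Hd (a + Cexp (x, y))%C) as [l Hl].
  - rewrite Mod. split; [apply exp_pos|]. cbn.
    assert (exp x <= exp s1) by (destruct Hx as [Hx| ->]; [left; now apply
      exp_increasing|right; reflexivity]). lra.
  - eexists. apply (Cder_comp (fun w => a + Cexp w)%C f (x, y) (0 + Cexp (x, y)) l); [|exact Hl].
    apply Cder_plus; [apply Cder_const|apply Cder_Cexp]. }
assert (G : flux g s0 0 (s1 - s0) (2 * PI) = 0).
{ apply goursat; [lra|lra|]. intros x y Hx _. apply Hg. lra. }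
unfold flux in G.
assert (HH : horizontal_integral g (0 + 2 * PI) s0 (s1 - s0) = horizontal_integral g 0 s0 (s1 -
  s0)).
{ unfold horizontal_integral. apply (RInt_ext (V := R_CompleteNormedModule)). intros x _.
  unfold g, Cexp. cbn.
  rewrite Rplus_0_l, cos_2PI, sin_2PI, cos_0, sin_0. reflexivity. }
rewrite HH in G. replace (s0 + (s1 - s0)) with s1 in G by ring.
assert (EV : forall x, x <= s1 -> ex_RInt (fun t => fst (g (x, t))) 0 (0 + 2 * PI)).
{ intros x Hx. apply (ex_RInt_continuous (V := R_CompleteNormedModule)). intros t Ht.
  destruct (Hg x t) as [l Hl]; try lra. eapply Cder_v_continuous; eassumption. }
assert (U : vertical_integral g s1 0 (2 * PI) <= 2 * PI * M).
{ replace (2 * PI * M) with (RInt (fun _ => M) 0 (0 + 2 * PI)).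
  - apply RInt_le; [lra|apply EV; lra|apply ex_RInt_const|]. intros x _. apply HM.
    rewrite Mod. exact E1.
  - rewrite RInt_const. unfold scal; cbn. unfold mult; cbn. ring. }
assert (L : 2 * PI * (fst (f a) - e) <= vertical_integral g s0 0 (2 * PI)).
{ replace (2 * PI * (fst (f a) - e)) with (RInt (fun _ => fst (f a) - e) 0 (0 + 2 * PI)).
  - apply RInt_le; [lra|apply ex_RInt_const|apply EV; lra|]. intros x _.
    specialize (K (a + Cexp (s0, x))%C). rewrite Mod in K. cbn in K. rewrite E0 in K.
    specialize (K ltac:(lra)). assert (K' := Rle_lt_trans _ _ _ (Rabs_fst_le_Cmod _) K).
    cbn in K'.
    apply Rabs_def2 in K'. unfold g. lra.
  - rewrite RInt_const. unfold scal; cbn. unfold mult; cbn. ring. }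
nra.
Qed.

(** Multiplying f by the conjugate of f(a) makes f(a) nonnegative, which reduces
    the modulus to the real part. *)
Lemma circle_max f a R r M : 0 < r < R ->
  (forall z, 0 < Cmod (z - a) < R -> exists l, Cder f z l) -> Ccont f a ->
  (forall z, Cmod (z - a) = r -> Cmod (f z) <= M) -> Cmod (f a) <= M.
Proof.
intros Hr Hd Hc HM.
assert (H : fst (Cconj (f a) * f a)%C <= Cmod (f a) * M).
{ apply (circle_max_re (fun z => Cconj (f a) * f z)%C a R r); auto.
  - intros z Hz. destruct (Hd z Hz) as [l Hl]. eexists. apply Cder_scal, Hl.
  - apply Ccont_mult; [apply Ccont_const|exact Hc].
  - intros z Hz. eapply Rle_trans; [apply fst_le_Cmod|]. rewrite Cmod_mult, Cmod_conj.
    apply Rmult_le_compat_l; [apply Cmod_ge_0|]. now apply HM. }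
assert (E : fst (Cconj (f a) * f a)%C = Cmod (f a) * Cmod (f a)) by (rewrite Cmod_sqr; cbn; ring).
rewrite E in H.
destruct (Rle_lt_or_eq_dec 0 _ (Cmod_ge_0 (f a))) as [L|L]; [nra|]. rewrite <- L.
specialize (HM (a + r)%C). replace (a + r - a)%C with (RtoC r) in HM by ring.
rewrite Cmod_R, Rabs_pos_eq in HM by lra. specialize (HM eq_refl).
assert (P := Cmod_ge_0 (f (a + r)%C)). lra.
Qed.

(** * Cauchy's estimate and the regularity of derivatives *)

Definition holo (f : C -> C) (a : C) (R : R) : Prop :=
  forall z, Cmod (z - a) < R -> exists l, Cder f z l.

Lemma holo_der f a R z : holo f a R -> Cmod (z - a) < R -> Cder f z (C_derive f z).
Proof. intros H Hz. destruct (H z Hz) as [l Hl]. now rewrite (Cder_C_derive _ _ _ Hl). Qed.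

Lemma holo_sub f a R b r : holo f a R -> Cmod (b - a) + r <= R -> holo f b r.
Proof.
intros H L z Hz. apply H. replace (z - a)%C with ((z - b) + (b - a))%C by ring.
eapply Rle_lt_trans; [apply Cmod_triangle|]. lra.
Qed.

(** The maximum principle for the slope function of f at a, whose value at a
    is l and which is at most 2 M / r on the circle of radius r < R. *)
Lemma cauchy_estimate f a R M l : 0 < R -> holo f a R ->
  (forall z, Cmod (z - a) < R -> Cmod (f z) <= M) -> Cder f a l -> Cmod l <= 2 * M / R.
Proof.
intros HR Hf HM (phi & Hc & Ha & E).
assert (HM0 : 0 <= M).
{ eapply Rle_trans; [apply Cmod_ge_0|apply (HM a)]. rewrite Cminus_diag, Cmod_0. exact HR. }
assert (K : forall r, 0 < r < R -> Cmod l * r <= 2 * M).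
{ intros r Hr. assert (Q : Cmod (phi a) <= 2 * M / r).
  { apply (circle_max phi a R r); auto.
    - intros z Hz. destruct (Hf z) as [m Hm]; [easy|].
      assert (N : (z - a)%C <> 0) by (apply Cmod_gt_0; easy).
      exists ((m * (z - a) - (f z - f a) * 1) / ((z - a) * (z - a)))%C.
      apply (Cder_ext_loc (fun w => (f w - f a) / (w - a))%C).
      + exists (Cmod (z - a)); split; [easy|]. intros w Hw.
        assert (N' : (w - a)%C <> 0).
        { intros Z. rewrite Cmod_minus_sym in Hw.
          replace (z - w)%C with ((z - a) - (w - a))%C in Hw by ring. rewrite Z in Hw.
          replace (z - a - 0)%C with (z - a)%C in Hw by ring. lra. }
        rewrite (E w). field. exact N'.
      + eapply Cder_eq; [apply (Cder_div (fun w => f w - f a)%C (fun w => w - a)%C z (m - 0) (1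
          - 0))|].
        * apply Cder_minus; [exact Hm|apply Cder_const].
        * apply Cder_minus; [apply Cder_id|apply Cder_const].
        * exact N.
        * field. exact N.
    - intros z Hz.
      assert (N : (z - a)%C <> 0) by (apply Cmod_gt_0; lra).
      replace (phi z) with ((f z - f a) / (z - a))%C by (rewrite (E z); field; exact N).
      rewrite Cmod_div, Hz by exact N. unfold Rdiv.
      apply Rmult_le_compat_r; [left; apply Rinv_0_lt_compat; lra|].
      assert (H1 := HM z ltac:(lra)). assert (H2 := HM a ltac:(rewrite Cminus_diag, Cmod_0; lra)).
      assert (H3 := Cmod_triangle_minus (f z) (f a)). lra. }
  rewrite Ha in Q. apply (Rmult_le_compat_r r) in Q; [|lra].
  unfold Rdiv in Q. rewrite Rmult_assoc, Rinv_l in Q by lra. lra. }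
apply (Rmult_le_reg_r R); [lra|]. unfold Rdiv. rewrite Rmult_assoc, Rinv_l, Rmult_1_r by lra.
apply Rnot_lt_le. intros L. assert (Pl := Cmod_ge_0 l).
assert (Q : 0 < Cmod l) by nra.
(* If |l| R > 2 M, this radius is below R and still violates K. *)
specialize (K ((R + 2 * M / Cmod l) / 2)).
assert (Q1 : 2 * M / Cmod l < R).
{ apply (Rmult_lt_reg_r (Cmod l)); [lra|]. unfold Rdiv. rewrite Rmult_assoc, Rinv_l; lra. }
assert (Q2 : 0 <= 2 * M / Cmod l).
{ unfold Rdiv. apply Rmult_le_pos; [lra|]. left. now apply Rinv_0_lt_compat. }
specialize (K ltac:(lra)).
replace (Cmod l * ((R + 2 * M / Cmod l) / 2)) with ((Cmod l * R + 2 * M) / 2) in K by (field;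
  lra). lra.
Qed.

Lemma segment_in_disc a r z w t : Cmod (z - a) < r -> Cmod (w - a) < r -> 0 <= t <= 1 ->
  Cmod (w + RtoC t * (z - w) - a) < r.
Proof.
intros Hz Hw Ht.
replace (w + RtoC t * (z - w) - a)%C with (RtoC t * (z - a) + RtoC (1 - t) * (w - a))%C
  by (rewrite RtoC_minus; ring).
eapply Rle_lt_trans; [apply Cmod_triangle|]. rewrite !Cmod_mult, !Cmod_R, !Rabs_pos_eq by lra.
destruct (Rle_lt_dec t (1/2)); nra.
Qed.

Lemma segment_mean_value F z k M :
  (forall t, 0 <= t <= 1 -> exists l, Cder F (z + RtoC t * k) l /\ Cmod l <= M) ->
  Cmod (F (z + k)%C - F z) <= M * Cmod k.
Proof.
intros H. assert (Q := Rder_mean_value (fun t => F (z + RtoC t * k)%C) (M * Cmod k)).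
cbv beta in Q. replace (z + 1 * k)%C with (z + k)%C in Q by ring.
replace (z + 0 * k)%C with z in Q by ring. apply Q.
intros t Ht. destruct (H t Ht) as (l & Hl & B). exists (l * k)%C. split.
- apply (Rder_comp F (fun t => z + RtoC t * k)%C); [exact Hl|apply Rder_line].
- rewrite Cmod_mult. apply Rmult_le_compat_r; [apply Cmod_ge_0|exact B].
Qed.

Lemma holo_lipschitz F a r M z w : holo F a r ->
  (forall z, Cmod (z - a) < r -> Cmod (C_derive F z) <= M) ->
  Cmod (z - a) < r -> Cmod (w - a) < r -> Cmod (F z - F w) <= M * Cmod (z - w).
Proof.
intros HF HM Hz Hw. replace (F z) with (F (w + (z - w))%C) by (f_equal; ring).
apply segment_mean_value. intros t Ht.
assert (Hs := segment_in_disc a r z w t Hz Hw Ht).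
exists (C_derive F (w + RtoC t * (z - w))%C). split; [|now apply HM].
eapply holo_der; eassumption.
Qed.

(** The limit is the supremum of the lower bounds q k - M |k|. *)
Lemma real_limit_at_0 (q : C -> R) rho M : 0 < rho ->
  (forall k l : C, k <> 0 -> l <> 0 -> Cmod k < rho -> Cmod l < rho ->
    Rabs (q k - q l) <= M * (Cmod k + Cmod l)) ->
  exists L, forall k : C, k <> 0 -> Cmod k < rho -> Rabs (q k - L) <= M * Cmod k.
Proof.
intros Hr H.
assert (K : forall k l : C, k <> 0 -> l <> 0 -> Cmod k < rho -> Cmod l < rho -> q k - M * Cmod
  k <= q l + M * Cmod l).
{ intros k l N1 N2 H1 H2. specialize (H k l N1 N2 H1 H2). apply Rabs_le_between in H. lra. }
assert (N0 : RtoC (rho / 2) <> 0) by (intros Z; apply RtoC_inj in Z; lra).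
assert (H0 : Cmod (RtoC (rho / 2)) < rho) by (rewrite Cmod_R, Rabs_pos_eq; lra).
destruct (completeness (fun r => exists k : C, k <> 0 /\ Cmod k < rho /\ r = q k - M * Cmod k))
  as [L [L1 L2]].
{ exists (q (RtoC (rho / 2)) + M * Cmod (RtoC (rho / 2))). intros r (k & Hk & Hk' & ->).
  apply K; assumption. }
{ eexists. exists (RtoC (rho / 2)). split; [exact N0|]. split; [exact H0|reflexivity]. }
exists L. intros k Hk Hk'. apply Rabs_le. split.
- assert (L <= q k + M * Cmod k); [|lra]. apply L2. intros r (l & Hl & Hl' & ->). apply K; auto.
- assert (q k - M * Cmod k <= L); [|lra]. apply L1. eauto.
Qed.

(** Cauchy's estimate turns smallness of functions into smallness of
    derivatives.  For f it makes f Lipschitz near a; for the increments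
    f (z + k) - f (z) it makes f' Lipschitz, so that the quotients
    (f (z + k) - f z) / k approach f' z uniformly at rate O(|k|); for differences of
    two such quotients it makes (f' (a + k) - f' a) / k a Cauchy family. *)
Lemma Cder_derive_exists f a R : 0 < R -> holo f a R -> exists l, Cder (C_derive f) a l.
Proof.
intros HR Hf.
destruct (Hf a) as [la Hla]; [rewrite Cminus_diag, Cmod_0; exact HR|].
destruct (proj1 (Ccont_eps _ _) (Cder_cont _ _ _ Hla) 1 Rlt_0_1) as (d & Hd & Kd).
set (r := Rmin d R). assert (Hr : 0 < r) by now apply Rmin_glb_lt.
assert (Hr1 : r <= d) by apply Rmin_l. assert (Hr2 : r <= R) by apply Rmin_r.
set (M0 := Cmod (f a) + 1). assert (PM0 : 0 < M0) by (unfold M0; assert (P := Cmod_ge_0 (f a));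
  lra).
assert (B0 : forall z, Cmod (z - a) < r -> Cmod (f z) <= M0).
{ intros z Hz. specialize (Kd z ltac:(lra)). assert (T := Cmod_triangle_rev (f z) (f a)).
  unfold M0. lra. }
(* M1 is a Lipschitz constant of f, M2 one of f', and M3 the rate of the quotients of f'. *)
set (M1 := 2 * M0 / (r / 2)). assert (PM1 : 0 < M1) by (unfold M1; apply Rdiv_lt_0_compat; lra).
assert (D : forall z, Cmod (z - a) < r -> Cder f z (C_derive f z)).
{ intros z Hz. apply (holo_der f a R); [exact Hf|lra]. }
assert (B1 : forall z, Cmod (z - a) < r / 2 -> Cmod (C_derive f z) <= M1).
{ intros z Hz. apply (cauchy_estimate f z); [lra| | |apply D; lra].
  - apply (holo_sub f a R); [exact Hf|lra].
  - intros w Hw. apply B0. replace (w - a)%C with ((w - z) + (z - a))%C by ring.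
    eapply Rle_lt_trans; [apply Cmod_triangle|]. lra. }
assert (B2 : forall z w, Cmod (z - a) < r / 2 -> Cmod (w - a) < r / 2 -> Cmod (f z - f w) <= M1
  * Cmod (z - w)).
{ intros z w. apply holo_lipschitz; [|exact B1]. apply (holo_sub f a R); [exact Hf|].
  rewrite Cminus_diag, Cmod_0. lra. }
assert (Dsh : forall z k, Cmod (z + k - a) < r -> Cder (fun w => f (w + k)%C) z (C_derive f (z
  + k)%C)).
{ intros z k Hz. eapply Cder_eq; [apply (Cder_comp (fun w => w + k)%C f z (1 + 0) (C_derive f
    (z + k)%C))|ring].
  - apply Cder_plus; [apply Cder_id|apply Cder_const].
  - now apply D. }
set (M2 := 2 * M1 / (r / 8)). assert (PM2 : 0 < M2) by (unfold M2; apply Rdiv_lt_0_compat; lra).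
assert (TR : forall b z s t, Cmod (z - b) < s -> Cmod (b - a) < t -> Cmod (z - a) < s + t).
{ intros b z s t H1 H2. replace (z - a)%C with ((z - b) + (b - a))%C by ring.
  eapply Rle_lt_trans; [apply Cmod_triangle|]. lra. }
assert (TK : forall z k s t, Cmod (z - a) < s -> Cmod k < t -> Cmod (z + k - a) < s + t).
{ intros z k s t H1 H2. replace (z + k - a)%C with ((z - a) + k)%C by ring.
  eapply Rle_lt_trans; [apply Cmod_triangle|]. lra. }
assert (B3 : forall b k, Cmod (b - a) < r / 8 -> Cmod k < r / 8 ->
   Cmod (C_derive f (b + k)%C - C_derive f b) <= M2 * Cmod k).
{ intros b k Hb Hk.
  replace (M2 * Cmod k) with (2 * (M1 * Cmod k) / (r / 8)) by (unfold M2; field; lra).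
  assert (Hg : forall z, Cmod (z - b) < r / 8 -> Cder (fun w => f (w + k)%C - f w)%C z
    (C_derive f (z + k)%C - C_derive f z)).
  { intros z Hz. assert (H1 := TR b z _ _ Hz Hb). assert (H2 := TK z k _ _ H1 Hk).
    apply Cder_minus; [apply Dsh|apply D]; lra. }
  apply (cauchy_estimate (fun w => f (w + k)%C - f w)%C b); [lra| | |].
  - intros z Hz. eexists. now apply Hg.
  - intros z Hz. assert (H1 := TR b z _ _ Hz Hb). assert (H2 := TK z k _ _ H1 Hk).
    replace (Cmod k) with (Cmod (z + k - z)) by (f_equal; ring). apply B2; lra.
  - apply Hg. rewrite Cminus_diag, Cmod_0. lra. }
set (rho := r / 16).
assert (B4 : forall z k, Cmod (z - a) < rho -> Cmod k < rho ->
  Cmod (f (z + k)%C - f z - C_derive f z * k) <= M2 * Cmod k * Cmod k).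
{ intros z k Hz Hk. unfold rho in *.
  replace (f (z + k)%C - f z - C_derive f z * k)%C with
   ((f (z + k)%C - C_derive f z * (z + k)) - (f z - C_derive f z * z))%C by ring.
  apply (segment_mean_value (fun w => f w - C_derive f z * w)%C). intros t Ht.
  assert (Hk' : Cmod (RtoC t * k) <= Cmod k).
  { rewrite Cmod_mult, Cmod_R, Rabs_pos_eq by lra. assert (P := Cmod_ge_0 k). nra. }
  assert (Hk2 := Rle_lt_trans _ _ _ Hk' Hk). assert (H2 := TK z _ _ _ Hz Hk2).
  exists (C_derive f (z + RtoC t * k)%C - C_derive f z * 1)%C. split.
  - apply Cder_minus; [apply D; lra|]. apply Cder_scal, Cder_id.
  - replace (C_derive f z * 1)%C with (C_derive f z) by ring.
    eapply Rle_trans; [apply B3; lra|]. apply Rmult_le_compat_l; lra. }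
assert (Prho : 0 < rho) by (unfold rho; lra).
set (M3 := 2 * M2 / rho). assert (PM3 : 0 < M3) by (unfold M3; apply Rdiv_lt_0_compat; lra).
set (q := fun k => ((C_derive f (a + k)%C - C_derive f a) / k)%C).
assert (B5 : forall k l : C, k <> 0 -> l <> 0 -> Cmod k < rho -> Cmod l < rho ->
  Cmod (q k - q l) <= M3 * (Cmod k + Cmod l)).
{ intros k l Nk Nl Hk Hl.
  replace (M3 * (Cmod k + Cmod l)) with (2 * (M2 * (Cmod k + Cmod l)) / rho) by (unfold M3;
    field; lra).
  set (S := fun k w => (/ k * (f (w + k)%C - f w))%C).
  assert (HS : forall k z, Cmod k < rho -> Cmod (z - a) < rho -> Cder (S k) z (/ k * (C_derive
    f (z + k)%C - C_derive f z))).
  { intros k' z Hk' Hz. assert (H2 := TK z _ _ _ Hz Hk'). unfold rho in *. apply Cder_scal.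
    apply Cder_minus; [apply Dsh|apply D]; lra. }
  assert (BS : forall (k z : C), k <> 0 -> Cmod k < rho -> Cmod (z - a) < rho -> Cmod (S k z -
    C_derive f z) <= M2 * Cmod k).
  { intros k' z N Hk' Hz. unfold S.
    replace (/ k' * (f (z + k') - f z) - C_derive f z)%C with ((f (z + k')%C - f z - C_derive f
      z * k') / k')%C by (field; exact N).
    rewrite Cmod_div by exact N. apply Cmod_gt_0 in N.
    apply (Rmult_le_reg_r (Cmod k')); [exact N|].
    unfold Rdiv. rewrite Rmult_assoc, Rinv_l, Rmult_1_r by lra. now apply B4. }
  apply (cauchy_estimate (fun w => S k w - S l w)%C a); [exact Prho| | |].
  - intros z Hz. eexists. apply Cder_minus; apply HS; assumption.
  - intros z Hz. assert (H1 := BS k z Nk Hk Hz). assert (H2 := BS l z Nl Hl Hz).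
    replace (S k z - S l z)%C with ((S k z - C_derive f z) - (S l z - C_derive f z))%C by ring.
    eapply Rle_trans; [apply Cmod_triangle_minus|]. lra.
  - assert (Ha : Cmod (a - a) < rho) by (rewrite Cminus_diag, Cmod_0; exact Prho).
    eapply Cder_eq; [apply Cder_minus; apply HS; assumption|]. unfold q. field. auto. }
destruct (real_limit_at_0 (fun k => fst (q k)) rho M3 Prho) as [L1 HL1].
{ intros k l Nk Nl Hk Hl. eapply Rle_trans; [|apply (B5 k l); assumption].
  eapply Rle_trans; [|apply Rabs_fst_le_Cmod]. right. f_equal. }
destruct (real_limit_at_0 (fun k => snd (q k)) rho M3 Prho) as [L2 HL2].
{ intros k l Nk Nl Hk Hl. eapply Rle_trans; [|apply (B5 k l); assumption].
  eapply Rle_trans; [|apply Rabs_snd_le_Cmod]. right. f_equal. }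
exists (L1, L2). apply Cder_eps. intros e He.
exists (Rmin rho (e / (2 * M3))). split; [apply Rmin_glb_lt; [lra|apply Rdiv_lt_0_compat; lra]|].
intros w Hw. assert (Hw1 := Rlt_le_trans _ _ _ Hw (Rmin_l _ _)).
assert (Hw2 := Rlt_le_trans _ _ _ Hw (Rmin_r _ _)).
destruct (Ceq_dec w a) as [->|N].
{ rewrite !Cminus_diag. replace (0 - (L1, L2) * 0)%C with (RtoC 0) by ring. rewrite Cmod_0. lra. }
apply Cminus_neq_0 in N.
replace (C_derive f w - C_derive f a - (L1, L2) * (w - a))%C with ((q (w - a) - (L1, L2)) * (w
  - a))%C.
2:{ unfold q. replace (a + (w - a))%C with w by ring. field. exact N. }
rewrite Cmod_mult. apply Rmult_le_compat_r; [apply Cmod_ge_0|].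
eapply Rle_trans; [apply Cmod_le_abs|]. specialize (HL1 _ N Hw1). specialize (HL2 _ N Hw1).
change (fst (q (w - a) - (L1, L2))%C) with (fst (q (w - a)%C) - L1).
change (snd (q (w - a) - (L1, L2))%C) with (snd (q (w - a)%C) - L2).
apply (Rmult_lt_compat_l (2 * M3)) in Hw2; [|lra].
replace (2 * M3 * (e / (2 * M3))) with e in Hw2 by (field; lra). lra.
Qed.

Lemma holo_derive f a R : holo f a R -> holo (C_derive f) a R.
Proof.
intros H z Hz. apply (Cder_derive_exists f z (R - Cmod (z - a))); [lra|].
apply (holo_sub f a R); [exact H|lra].
Qed.

(** * Point picking *)

Lemma bounded_on_closed_disc Q c r :
  (forall z, Cmod (z - c) <= r -> Ccont Q z) ->
  exists M, forall z, Cmod (z - c) <= r -> Cmod (Q z) <= M.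
Proof.
intros H. destruct (Rle_lt_dec 0 r) as [Hr|Hr].
2:{ exists 0. intros z Hz. assert (P := Cmod_ge_0 (z - c)). lra. }
destruct (rectangle_induction (fun x y p q => exists M, forall s t, x <= s <= x + p -> y <= t
  <= y + q ->
   Cmod ((s, t) - c) <= r -> Cmod (Q (s, t)) <= M) (fst c - r) (snd c - r) (2 * r) (2 * r)) as
     [M HM]; [lra|lra| | |].
- intros x y p q Hp Hq _ _ _ _ [M1 H1] [M2 H2] [M3 H3] [M4 H4].
  exists (Rmax (Rmax M1 M2) (Rmax M3 M4)). intros s t Hs Ht Hd.
  destruct (Rle_lt_dec s (x + p / 2)), (Rle_lt_dec t (y + q / 2)).
  + eapply Rle_trans; [apply H1; auto; lra|]. eapply Rle_trans; [apply Rmax_l|apply Rmax_l].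
  + eapply Rle_trans; [apply H3; auto; lra|]. eapply Rle_trans; [apply Rmax_l|apply Rmax_r].
  + eapply Rle_trans; [apply H2; auto; lra|]. eapply Rle_trans; [apply Rmax_r|apply Rmax_l].
  + eapply Rle_trans; [apply H4; auto; lra|]. eapply Rle_trans; [apply Rmax_r|apply Rmax_r].
- intros X Y _ _. destruct (Rle_lt_dec (Cmod ((X, Y) - c)) r) as [L|L].
  + destruct (proj1 (Ccont_eps _ _) (H _ L) 1 Rlt_0_1) as (d & Hd & K).
    exists (d / 2). split; [lra|]. intros x y p q Hp Hq HX HY _ _ _ _.
    exists (Cmod (Q (X, Y)) + 1). intros s t Hs Ht _.
    specialize (K (s, t)). assert (T := Cmod_triangle_rev (Q (s, t)) (Q (X, Y))).
    assert (Cmod ((s, t) - (X, Y)) < d); [|specialize (K ltac:(assumption)); lra].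
    eapply Rle_lt_trans; [apply Cmod_le_abs|]. cbn.
    assert (Rabs (s + - X) <= p) by (apply Rabs_le; lra).
    assert (Rabs (t + - Y) <= q) by (apply Rabs_le; lra). lra.
  + exists ((Cmod ((X, Y) - c) - r) / 2). split; [lra|]. intros x y p q Hp Hq HX HY _ _ _ _.
    exists 0. intros s t Hs Ht Hd. exfalso.
    assert (Cmod ((X, Y) - (s, t)) <= p + q).
    { eapply Rle_trans; [apply Cmod_le_abs|]. cbn.
      assert (Rabs (X + - s) <= p) by (apply Rabs_le; lra).
      assert (Rabs (Y + - t) <= q) by (apply Rabs_le; lra). lra. }
    assert (T := Cmod_triangle ((X, Y) - (s, t)) ((s, t) - c)).
    replace ((X, Y) - (s, t) + ((s, t) - c))%C with ((X, Y) - c)%C in T by ring. lra.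
- exists M. intros z Hz. destruct z as [s t].
  assert (A1 := Rle_trans _ _ _ (Rabs_fst_le_Cmod _) Hz).
  assert (A2 := Rle_trans _ _ _ (Rabs_snd_le_Cmod _) Hz). cbn in A1, A2.
  apply Rabs_le_between in A1. apply Rabs_le_between in A2. apply HM; auto; lra.
Qed.

(** At a near maximum z1 of (R/2 - |z - c|) |Q z|, the weight changes by a
    factor of at most 3/2 within a third of its value, so |Q| at most doubles
    there.  The product |Q z1| rho, which measures the size of the disc in the
    natural unit 1 / |Q z1|, does not drop much below its value at c. *)
Lemma point_picking Q c R : 0 < R -> (forall z, Cmod (z - c) < R -> Ccont Q z) -> Q c <> 0 ->
  exists z1 rho, 0 < rho /\ 0 < Cmod (Q z1) /\ Cmod (Q c) * R / 8 <= Cmod (Q z1) * rho /\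
    (forall z, Cmod (z - z1) < rho -> Cmod (z - c) + rho <= R /\ Cmod (Q z) <= 2 * Cmod (Q z1)).
Proof.
intros HR Hc N. apply Cmod_gt_0 in N.
set (r := R / 2).
destruct (bounded_on_closed_disc Q c r) as [M HM].
{ intros z Hz. apply Hc. unfold r in *. lra. }
set (W := fun z => (r - Cmod (z - c)) * Cmod (Q z)).
assert (Wc : W c = r * Cmod (Q c)) by (unfold W; rewrite Cminus_diag, Cmod_0; ring).
assert (Hr : 0 < r) by (unfold r; lra).
destruct (completeness (fun x => exists z, Cmod (z - c) <= r /\ x = W z)) as [S [S1 S2]].
{ exists (r * M). intros x (z & Hz & ->). unfold W. specialize (HM z Hz).
  assert (P1 := Cmod_ge_0 (z - c)). assert (P2 := Cmod_ge_0 (Q z)). apply Rmult_le_compat; lra. }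
{ exists (W c), c. split; [|easy]. rewrite Cminus_diag, Cmod_0. lra. }
assert (SW : forall z, Cmod (z - c) <= r -> W z <= S) by (intros z Hz; apply S1; eauto).
assert (Sc : r * Cmod (Q c) <= S).
{ rewrite <- Wc. apply SW. rewrite Cminus_diag, Cmod_0. lra. }
assert (PS : 0 < S) by nra.
(* With rho a third of the weight at z1, the constant 3/4 yields exactly the factor 2. *)
assert (exists z1, Cmod (z1 - c) <= r /\ 3 / 4 * S < W z1) as (z1 & Hz1 & W1).
{ apply NNPP. intros Hn. assert (S <= 3 / 4 * S); [|lra]. apply S2. intros x (z & Hz & ->).
  apply Rnot_lt_le. intros L. apply Hn. eauto. }
assert (P1 := Cmod_ge_0 (Q z1)).
set (t := r - Cmod (z1 - c)). unfold W in W1. fold t in W1.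
assert (Pt : 0 < t) by (unfold t in *; nra).
exists z1, (t / 3). split; [lra|]. split; [nra|]. split.
- unfold r in Sc. nra.
- intros z Hz. assert (T : Cmod (z - c) <= Cmod (z - z1) + Cmod (z1 - c)).
  { replace (z - c)%C with ((z - z1) + (z1 - c))%C by ring. apply Cmod_triangle. }
  assert (Cmod (z - c) <= r) by (unfold t in *; lra).
  assert (P2 := Cmod_ge_0 (z1 - c)). split; [unfold t, r in *; lra|].
  specialize (SW z ltac:(assumption)). unfold W in SW. assert (P := Cmod_ge_0 (Q z)).
  assert (2 / 3 * t <= r - Cmod (z - c)) by (unfold t in *; lra).
  assert (2 / 3 * t * Cmod (Q z) <= S) by nra. nra.
Qed.

(** * A Riccati inequality *)

Lemma C2_neq_0 : RtoC 2 <> 0.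
Proof. intros Z; apply RtoC_inj in Z; lra. Qed.
Ltac Cfield := field; repeat split; auto using C2_neq_0.

Lemma holo_disk_sub f z0 : holo f 0 1 -> holo f z0 (1 - Cmod z0).
Proof.
intros H. apply (holo_sub f 0 1); [exact H|]. replace (z0 - 0)%C with z0 by ring. lra.
Qed.

Lemma Cmod_triangle_sub a b : Cmod a <= Cmod (a - b) + Cmod b.
Proof. assert (T := Cmod_triangle_rev a b). lra. Qed.

(** On a ray where w = u P starts at A > 0, the exact solution of w' = w^2/2
    satisfies (1 - A t / 2) w = A.  The defect g = (1 - A t / 2) w - A solves the
    linear equation g' = (w/2) g + (1 - A t / 2) e, with e the error in the
    Riccati equation and |w| <= 2A, so Gronwall keeps |g| small up to the blow-up
    time 2 / A.  There the factor vanishes and g = - A, whatever P is. *)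
Lemma riccati_bound (P : C -> C) K : 0 <= K -> holo P 0 1 ->
  (forall z, Disk z -> Cmod (C_derive P z - / 2 * (P z * P z)) <=
     K * (/ (1 - Cmod z) ^ 2 + Cmod (P z) / (1 - Cmod z))) ->
  forall z0, Disk z0 -> Cmod (P z0) * (1 - Cmod z0) <= 8 * (3 + 3 * K * (exp 2 - 1)).
Proof.
intros HK HP H z0 Hz0. unfold Disk in *. apply Rnot_lt_le. intros L.
assert (HP0 := holo_disk_sub P z0 HP).
assert (E2 : 1 < exp 2) by (rewrite <- exp_0; apply exp_increasing; lra).
assert (N0 : P z0 <> 0).
{ intros Z. rewrite Z, Cmod_0 in L. nra. }
destruct (point_picking P z0 (1 - Cmod z0)) as (z1 & rho & Hrho & HA & HN & Hb); auto; [lra| |].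
{ intros z Hz. destruct (HP0 z Hz) as [l Hl]. eapply Cder_cont, Hl. }
set (A := Cmod (P z1)) in *. set (n := A * rho) in *.
assert (Hn : 3 + 3 * K * (exp 2 - 1) < n) by lra.
assert (K2 : 0 <= 3 * K * (exp 2 - 1)) by (apply Rmult_le_pos; lra).
assert (N1 : P z1 <> 0) by (apply Cmod_gt_0; exact HA).
(* The direction in which P z1 is rotated to A. *)
set (u := (Cconj (P z1) / RtoC A)%C).
assert (NA : RtoC A <> 0) by (intros Z; apply RtoC_inj in Z; lra).
assert (Hu : Cmod u = 1).
{ unfold u. rewrite Cmod_div, Cmod_conj, Cmod_R, Rabs_pos_eq by (auto; lra). fold A. field. lra. }
assert (HuP : (u * P z1)%C = RtoC A).
{ unfold u. replace (Cconj (P z1) / A * P z1)%C with ((P z1 * Cconj (P z1)) / A)%C by (field;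
    auto).
  rewrite <- Cmod2_conj. fold A. rewrite RtoC_pow. field. auto. }
set (z := fun t : R => (z1 + RtoC t * u)%C).
assert (Hz : forall t, 0 <= t <= 2 / A -> Cmod (z t - z1) < rho).
{ intros t Ht. unfold z. replace (z1 + t * u - z1)%C with (RtoC t * u)%C by ring.
  rewrite Cmod_mult, Hu, Cmod_R, Rabs_pos_eq by lra. rewrite Rmult_1_r.
  apply Rle_lt_trans with (2 / A); [lra|]. apply (Rmult_lt_reg_r A); [exact HA|].
  unfold Rdiv. rewrite Rmult_assoc, Rinv_l by lra. unfold n in Hn. lra. }
assert (Hd : forall t, 0 <= t <= 2 / A -> rho <= 1 - Cmod (z t)).
{ intros t Ht. destruct (Hb _ (Hz t Ht)) as [B _]. assert (T := Cmod_triangle_sub (z t) z0). lra.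
  }
set (w := fun t => (u * P (z t))%C).
set (g := fun t => ((1 - RtoC t * (RtoC A / 2)) * w t - RtoC A)%C).
assert (G := gronwall g (2 / A) A (3 * K * (A * A) / n)).
assert (G0 : g 0 = 0).
{ unfold g, w, z. replace (z1 + 0 * u)%C with z1 by ring. rewrite HuP. ring. }
assert (GT : g (2 / A) = (- RtoC A)%C).
{ unfold g. rewrite RtoC_div by lra. replace (1 - 2 / A * (A / 2))%C with (RtoC 0); [ring|].
  Cfield. }
rewrite GT, Cmod_opp, Cmod_R, Rabs_pos_eq in G by lra.
replace (A * (2 / A)) with 2 in G by (field; lra).
assert (Q : A <= 3 * K * (A * A) / n / A * (exp 2 - 1)).
{ apply G; auto.
  - unfold Rdiv. apply Rmult_le_pos; [nra|]. left; apply Rinv_0_lt_compat; lra.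
  - apply Rlt_le, Rdiv_lt_0_compat; lra.
  - intros t Ht. assert (Ht' := Hz t Ht). specialize (Hd t Ht).
    destruct (Hb _ Ht') as [_ HPt].
    assert (Ht3 : Cmod (z t) < 1) by lra.
    assert (DP : Cder P (z t) (C_derive P (z t))).
    { apply (holo_der P 0 1); [exact HP|]. replace (z t - 0)%C with (z t) by ring. exact Ht3. }
    set (e := (u * u * (C_derive P (z t) - / 2 * (P (z t) * P (z t))))%C).
    assert (Hw : Rder w t (u * u * C_derive P (z t))%C).
    { eapply Rder_eq; [exact (Rder_mult _ _ t _ _ (Rder_const u t) (Rder_comp P z t _ _ DP
        (Rder_line z1 u t)))|].
      cbv beta. ring. }
    exists (/ 2 * w t * g t + (1 - RtoC t * (RtoC A / 2)) * e)%C. split.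
    + eapply Rder_eq.
      * unfold g. apply Rder_plus; [|apply Rder_const]. apply Rder_mult; [|exact Hw].
        apply (Rder_ext (fun t => 1 + RtoC t * (- (RtoC A / 2)))%C); [intros s; ring|].
        apply Rder_line.
      * unfold e, g, w. Cfield.
    + assert (Be : Cmod e <= 3 * K * (A * A) / n).
      { unfold e. rewrite !Cmod_mult, Hu, !Rmult_1_l. eapply Rle_trans; [apply H; exact Ht3|].
        replace (3 * K * (A * A) / n) with (K * (3 * (A * A) / n)) by (field; lra).
        apply Rmult_le_compat_l; [exact HK|].
        assert (I1 : / (1 - Cmod (z t)) <= A / n).
        { replace (A / n) with (/ rho) by (unfold n; field; lra). apply Rinv_le_contravar; lra. }
        assert (I0 : 0 < / (1 - Cmod (z t))) by (apply Rinv_0_lt_compat; lra).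
        assert (PP := Cmod_ge_0 (P (z t))).
        unfold Rdiv at 1. rewrite <- pow_inv.
        (* One factor A / n is kept, the other is bounded by A. *)
        assert (I2 : (/ (1 - Cmod (z t))) ^ 2 <= A / n * (A * 1)).
        { simpl. rewrite Rmult_1_r.
          assert (A / n <= A). { unfold Rdiv. rewrite <- (Rmult_1_r A) at 2.
          apply Rmult_le_compat_l; [lra|].
            rewrite <- Rinv_1. apply Rinv_le_contravar; lra. }
          apply Rmult_le_compat; lra. }
        assert (I3 : Cmod (P (z t)) * / (1 - Cmod (z t)) <= 2 * A * (A / n)) by (apply
          Rmult_le_compat; lra).
        replace (3 * (A * A) / n) with (A / n * (A * 1) + 2 * A * (A / n)) by (field; lra). lra. }
      eapply Rle_trans; [apply Cmod_triangle|]. apply Rplus_le_compat.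
      * rewrite !Cmod_mult. apply Rmult_le_compat_r; [apply Cmod_ge_0|].
        unfold w. rewrite Cmod_mult, Hu, <- RtoC_inv, Cmod_R, Rabs_pos_eq by lra. lra.
      * rewrite Cmod_mult. rewrite <- (Rmult_1_l (3 * K * (A * A) / n)).
        apply Rmult_le_compat; try apply Cmod_ge_0; [|exact Be].
        replace (1 - t * (A / 2))%C with (RtoC (1 - t * (A / 2))).
        2:{ rewrite RtoC_minus, RtoC_mult, RtoC_div by lra. reflexivity. }
        rewrite Cmod_R. destruct Ht as [Ht1 Ht2].
        apply (Rmult_le_compat_r A) in Ht2; [|lra]. unfold Rdiv in Ht2.
        rewrite Rmult_assoc, Rinv_l in Ht2 by lra.
        apply Rabs_le. nra. }
replace (3 * K * (A * A) / n / A * (exp 2 - 1)) with (A * (3 * K * (exp 2 - 1)) / n) in Q by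
  (field; lra).
apply (Rmult_le_compat_r n) in Q; [|lra]. unfold Rdiv in Q.
rewrite Rmult_assoc, Rinv_l in Q by lra. nra.
Qed.

(** * Univalent functions *)

Lemma Cexp_small w : Cmod w <= 1 / 4 -> Cmod (Cexp w) <= 4 / 3.
Proof.
intros Hw. rewrite Cmod_Cexp. assert (F := fst_le_Cmod w).
apply Rle_trans with (exp (1 / 4)).
{ destruct (Rle_lt_or_eq_dec (fst w) (1/4)) as [L|E]; [lra|left; now apply
    exp_increasing|rewrite E; lra]. }
assert (E := exp_ineq1_le (- (1 / 4))). rewrite exp_Ropp in E.
assert (P := exp_pos (1 / 4)). apply (Rmult_le_compat_r (exp (1/4))) in E; [|lra].
rewrite Rinv_l in E; lra.
Qed.

Lemma Cexp_minus_1_lower w : Cmod w = 1 / 4 -> 1 / 6 <= Cmod (Cexp w - 1).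
Proof.
intros Hw.
assert (B1 : forall t, 0 <= t <= 1 -> Cmod (RtoC t * w) <= 1 / 4).
{ intros t Ht. rewrite Cmod_mult, Hw, Cmod_R, Rabs_pos_eq; lra. }
assert (B2 : forall v, Cmod v <= 1 / 4 -> Cmod (Cexp v - 1) <= 1 / 3).
{ intros v Hv. replace (Cexp v) with (Cexp (0 + v)%C) by (f_equal; ring). rewrite <- Cexp_0.
  eapply Rle_trans; [apply (segment_mean_value Cexp 0 v (4/3))|].
  - intros t Ht. exists (Cexp (0 + t * v)%C). split; [apply Cder_Cexp|]. apply Cexp_small.
    replace (0 + t * v)%C with (t * v)%C by ring. rewrite Cmod_mult, Cmod_R, Rabs_pos_eq by lra.
    assert (P := Cmod_ge_0 v). nra.
  - lra. }
assert (B3 : Cmod ((Cexp (0 + w) - (0 + w)) - (Cexp 0 - 0)) <= 1 / 3 * Cmod w).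
{ apply (segment_mean_value (fun v => Cexp v - v)%C). intros t Ht.
  exists (Cexp (0 + t * w) - 1)%C. split; [apply Cder_minus; [apply Cder_Cexp|apply Cder_id]|].
  apply B2. replace (0 + t * w)%C with (t * w)%C by ring. auto. }
replace (0 + w)%C with w in B3 by ring. rewrite Cexp_0, Hw in B3.
assert (T := Cmod_triangle_rev w (- (Cexp w - 1 - w))%C).
replace (w - - (Cexp w - 1 - w))%C with (Cexp w - 1)%C in T by ring.
rewrite Cmod_opp in T. replace (Cexp w - w - (1 - 0))%C with (Cexp w - 1 - w)%C in B3 by ring.
lra.
Qed.

(** The factor 8 is lost in point picking.  With n = A rho > 11000 the error
    648 / n below stays under 1/16. *)
Definition log_derivative_constant : R := 8 * 11000.

(** A bound of Bloch type.  On the picked disc Q = G'/G is nearly the constant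
    a = Q z1, at the scale 1 / A = 1 / |a|, so H = (G / G z1) exp (- a (z - z1)) is
    nearly 1 and G / G z1 is nearly exp (a (z - z1)).  The latter takes the value 1
    again at z2 = z1 + 2 pi i / a.  By the maximum principle for the inverse of
    K = G / G z1 - 1, so does G / G z1 near z2, which contradicts injectivity. *)
Lemma nonvanishing_injective_log_derivative G c R : 0 < R -> holo G c R ->
  (forall z, Cmod (z - c) < R -> G z <> 0) ->
  (forall z w, Cmod (z - c) < R -> Cmod (w - c) < R -> G z = G w -> z = w) ->
  Cmod (C_derive G c / G c) * R <= log_derivative_constant.
Proof.
intros HR HG HN HI. apply Rnot_lt_le. intros L. unfold log_derivative_constant in L.
set (Q := fun z => (C_derive G z / G z)%C).
assert (HQ : holo Q c R).
{ intros z Hz. destruct (holo_derive _ _ _ HG z Hz) as [l Hl]. destruct (HG z Hz) as [m Hm].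
  eexists. apply Cder_div; [exact Hl|exact Hm|auto]. }
assert (N0 : Q c <> 0).
{ intros Z. fold (Q c) in L. rewrite Z, Cmod_0 in L. lra. }
destruct (point_picking Q c R) as (z1 & rho & Hrho & HA & Hn & Hb); auto.
{ intros z Hz. destruct (HQ z Hz) as [l Hl]. eapply Cder_cont, Hl. }
fold (Q c) in L. set (a := Q z1) in *. set (A := Cmod a) in *. set (n := A * rho) in *.
assert (Hn' : 11000 < n) by lra.
assert (Na : a <> 0) by (apply Cmod_gt_0; exact HA).
assert (Hsub : forall z, Cmod (z - z1) < rho -> Cmod (z - c) < R).
{ intros z Hz. destruct (Hb z Hz). lra. }
assert (HGz1 : G z1 <> 0) by (apply HN, Hsub; rewrite Cminus_diag, Cmod_0; exact Hrho).
assert (LQ : forall z, Cmod (z - z1) < rho / 2 -> Cmod (Q z - a) <= 8 * A / rho * Cmod (z - z1)).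
{ intros z Hz. apply (holo_lipschitz Q z1 (rho / 2)); auto.
  - intros v Hv. apply HQ, Hsub. lra.
  - intros v Hv. replace (8 * A / rho) with (2 * (2 * A) / (rho / 2)) by (field; lra).
    assert (Hs : forall y, Cmod (y - v) < rho / 2 -> Cmod (y - z1) < rho).
    { intros y Hy. replace (y - z1)%C with ((y - v) + (v - z1))%C by ring.
      eapply Rle_lt_trans; [apply Cmod_triangle|]. lra. }
    apply (cauchy_estimate Q v); [lra| | |].
    + intros y Hy. apply HQ, Hsub, Hs, Hy.
    + intros y Hy. apply Hb, Hs, Hy.
    + apply (holo_der Q c R); [exact HQ|]. apply Hsub. lra.
  - rewrite Cminus_diag, Cmod_0. lra. }
set (H := fun z => (G z / G z1 * Cexp (- (a * (z - z1))))%C).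
assert (DH : forall z, Cmod (z - z1) < rho -> Cder H z ((Q z - a) * H z)).
{ intros z Hz. assert (Hz' := Hsub z Hz). assert (DG := holo_der G c R z HG Hz').
  eapply Cder_eq; [apply Cder_mult|].
  - apply (Cder_div G (fun _ => G z1)); [exact DG|apply Cder_const|exact HGz1].
  - apply (Cder_comp (fun z => - (a * (z - z1)))%C Cexp); [|apply Cder_Cexp].
    apply Cder_opp, Cder_scal, Cder_minus; [apply Cder_id|apply Cder_const].
  - cbv beta. unfold Q, H. field. split; auto. }
(* 9 / A leaves room for the period 2 pi / A and the circle around z2. *)
assert (far : 9 / A < rho / 2).
{ apply (Rmult_lt_reg_r A); [exact HA|]. unfold Rdiv. rewrite Rmult_assoc, Rinv_l by lra.
  unfold n in Hn'. lra. }
assert (BH : forall z, Cmod (z - z1) <= 9 / A -> Cmod (H z - 1) <= 1 / 15).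
{ intros z Hz. set (k := (z - z1)%C) in *.
  set (g := fun t => (H (z1 + RtoC t * k) - 1)%C).
  assert (GW := gronwall g 1 (1/16) (1/16) ltac:(lra) ltac:(lra) ltac:(lra)).
  assert (E0 : g 0 = 0).
  { unfold g, H. replace (z1 + 0 * k)%C with z1 by ring.
    replace (- (a * (z1 - z1)))%C with (RtoC 0) by ring.
    rewrite Cexp_0. field. exact HGz1. }
  assert (E1 : g 1 = (H z - 1)%C).
  { unfold g, k. f_equal. f_equal. ring. }
  rewrite E1 in GW. eapply Rle_trans; [apply GW; [exact E0|]|].
  - intros t Ht.
    assert (Bk : Cmod (z1 + RtoC t * k - z1) <= 9 / A).
    { replace (z1 + t * k - z1)%C with (RtoC t * k)%C by ring.
      rewrite Cmod_mult, Cmod_R, Rabs_pos_eq by lra.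
      assert (P := Cmod_ge_0 k). nra. }
    exists ((Q (z1 + RtoC t * k)%C - a) * H (z1 + RtoC t * k)%C * k + 0)%C. split.
    + apply Rder_plus; [|apply Rder_const].
      apply (Rder_comp H (fun t => z1 + RtoC t * k)%C); [apply DH; lra|apply Rder_line].
    + rewrite Cplus_0_r, !Cmod_mult. specialize (LQ (z1 + t * k)%C ltac:(lra)).
      assert (B1 : Cmod (Q (z1 + RtoC t * k)%C - a) * Cmod k <= 1 / 16).
      { apply Rle_trans with (8 * A / rho * (9 / A) * (9 / A)).
        - apply Rmult_le_compat; try apply Cmod_ge_0; [|exact Hz].
          eapply Rle_trans; [exact LQ|]. apply Rmult_le_compat_l; [|exact Bk].
          apply Rlt_le, Rdiv_lt_0_compat; lra.
        - replace (8 * A / rho * (9 / A) * (9 / A)) with (648 / n) by (unfold n; field; lra).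
          apply (Rmult_le_reg_r n); [lra|]. unfold Rdiv. rewrite Rmult_assoc, Rinv_l by lra. lra.
          }
      assert (B2 : Cmod (H (z1 + RtoC t * k)%C) <= Cmod (g t) + 1).
      { assert (T := Cmod_triangle_sub (H (z1 + RtoC t * k)%C) 1). rewrite Cmod_1 in T. exact T. }
      assert (P1 := Cmod_ge_0 (H (z1 + RtoC t * k)%C)). assert (P2 := Cmod_ge_0 (g t)).
      replace (Cmod (Q (z1 + t * k)%C - a) * Cmod (H (z1 + t * k)%C) * Cmod k)
       with (Cmod (Q (z1 + t * k)%C - a) * Cmod k * Cmod (H (z1 + t * k)%C)) by ring.
      apply Rle_trans with (1 / 16 * Cmod (H (z1 + t * k)%C)); [apply Rmult_le_compat_r;
        assumption|]. lra.
  - replace (1 / 16 / (1 / 16)) with 1 by field.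
    assert (E := exp_ineq1_le (- (1 / 16))). rewrite exp_Ropp in E. rewrite Rmult_1_r.
    assert (P := exp_pos (1 / 16)). apply (Rmult_le_compat_r (exp (1/16))) in E; [|lra].
    rewrite Rinv_l in E; lra. }
assert (PI1 := PI_4). assert (PI0 := PI2_1).
set (z2 := (z1 + RtoC (2 * PI) * Ci / a)%C).
assert (Hz2 : Cmod (z2 - z1) = 2 * PI / A).
{ unfold z2. replace (z1 + RtoC (2 * PI) * Ci / a - z1)%C with (RtoC (2 * PI) * Ci / a)%C by ring.
  rewrite Cmod_div, Cmod_mult, Cmod_Ci, Cmod_R, Rabs_pos_eq by (auto; lra). fold A. field. lra. }
assert (IA : 0 < / A) by (apply Rinv_0_lt_compat; lra).
unfold Rdiv in Hz2.
assert (Near : forall z, Cmod (z - z2) < 1 / A -> Cmod (z - z1) <= 9 / A /\ 0 < Cmod (z - z1)).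
{ intros z Hz. unfold Rdiv in *. split.
  - replace (z - z1)%C with ((z - z2) + (z2 - z1))%C by ring.
    eapply Rle_trans; [apply Cmod_triangle|]. nra.
  - assert (T := Cmod_triangle (z2 - z) (z - z1)).
    replace (z2 - z + (z - z1))%C with (z2 - z1)%C in T by ring.
    rewrite Cmod_minus_sym in Hz. nra. }
set (K := fun z => (G z / G z1 - 1)%C).
assert (NK : forall z, Cmod (z - z2) < 1 / A -> K z <> 0).
{ intros z Hz Z. destruct (Near z Hz) as [H1 H2].
  assert (E : G z = G z1).
  { replace (G z) with ((K z + 1) * G z1)%C by (unfold K; field; exact HGz1). rewrite Z. ring. }
  apply HI in E; [|apply Hsub; lra|apply Hsub; rewrite Cminus_diag, Cmod_0; exact Hrho].
  rewrite E, Cminus_diag, Cmod_0 in H2. lra. }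
assert (KE : forall z, K z = ((H z - 1) * Cexp (a * (z - z2)) + (Cexp (a * (z - z2)) - 1))%C).
{ intros z. assert (E : Cexp (a * (z - z2)) = Cexp (a * (z - z1))).
  { replace (a * (z - z1))%C with (a * (z - z2) + RtoC (2 * PI) * Ci)%C by (unfold z2; field;
      exact Na).
    rewrite Cexp_plus. replace (Cexp (RtoC (2 * PI) * Ci)) with (RtoC 1); [ring|].
    unfold Cexp. cbn. replace (2 * PI * 0 - 0 * 1) with 0 by ring.
    replace (2 * PI * 1 + 0 * 0) with (2 * PI) by ring.
    rewrite exp_0, cos_2PI, sin_2PI. unfold RtoC. f_equal; ring. }
  rewrite E. unfold K, H.
  replace ((G z / G z1 * Cexp (- (a * (z - z1))) - 1) * Cexp (a * (z - z1)) + (Cexp (a * (z -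
    z1)) - 1))%C
   with (G z / G z1 * (Cexp (- (a * (z - z1))) * Cexp (a * (z - z1))) - 1)%C by ring.
  rewrite <- Cexp_plus. replace (- (a * (z - z1)) + a * (z - z1))%C with (RtoC 0) by ring.
  rewrite Cexp_0. ring. }
assert (Hz22 : Cmod (z2 - z2) < 1 / A) by (rewrite Cminus_diag, Cmod_0; unfold Rdiv; lra).
(* On the circle of radius 1 / (4 A) about z2, |K| >= 1/6 - (1/15) (4/3) = 7/90, whereas
   |K z2| <= 1/15. *)
assert (Mx : Cmod (/ K z2) <= 90 / 7).
{ apply (circle_max (fun z => / K z)%C z2 (1 / A) (1 / 4 / A)).
  - unfold Rdiv. lra.
  - intros z [_ Hz]. destruct (Near z Hz) as [H1 _].
    assert (DG := holo_der G c R z HG (Hsub z ltac:(lra))).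
    eexists. apply Cder_inv; [|now apply NK].
    apply Cder_minus; [|apply Cder_const].
    apply (Cder_div G (fun _ => G z1)); [exact DG|apply Cder_const|exact HGz1].
  - assert (DG := holo_der G c R z2 HG (Hsub z2 ltac:(destruct (Near z2 Hz22); lra))).
    apply Ccont_inv; [|now apply NK]. eapply Cder_cont. apply Cder_minus; [|apply Cder_const].
    apply (Cder_div G (fun _ => G z1)); [exact DG|apply Cder_const|exact HGz1].
  - intros z Hz. assert (Hz' : Cmod (z - z2) < 1 / A) by (unfold Rdiv in *; lra).
    rewrite Cmod_inv by now apply NK.
    assert (Hw : Cmod (a * (z - z2)) = 1 / 4).
    { rewrite Cmod_mult, Hz. fold A. field. lra. }
    assert (W1 := Cexp_minus_1_lower _ Hw). assert (W2 := Cexp_small (a * (z - z2))%C ltac:(lra)).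
    destruct (Near z Hz') as [H1 _]. specialize (BH z H1).
    assert (LB : 7 / 90 <= Cmod (K z)).
    { rewrite KE. assert (T := Cmod_triangle_rev (Cexp (a * (z - z2)) - 1) (- ((H z - 1) * Cexp
        (a * (z - z2))))).
      rewrite Cmod_opp, Cmod_mult in T.
      replace (Cexp (a * (z - z2)) - 1 - - ((H z - 1) * Cexp (a * (z - z2))))%C with
         ((H z - 1) * Cexp (a * (z - z2)) + (Cexp (a * (z - z2)) - 1))%C in T by ring.
      assert (P1 := Cmod_ge_0 (H z - 1)). assert (P2 := Cmod_ge_0 (Cexp (a * (z - z2)))).
      assert (Cmod (H z - 1) * Cmod (Cexp (a * (z - z2))) <= 1 / 15 * (4 / 3)) by (apply
        Rmult_le_compat; lra). lra. }
    replace (90 / 7) with (/ (7 / 90)) by field. apply Rinv_le_contravar; lra. }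
rewrite Cmod_inv in Mx by now apply NK.
assert (K2 : Cmod (K z2) <= 1 / 15).
{ rewrite KE. replace (a * (z2 - z2))%C with (RtoC 0) by ring. rewrite Cexp_0.
  replace ((H z2 - 1) * 1 + (1 - 1))%C with (H z2 - 1)%C by ring. apply BH. apply Near, Hz22. }
assert (K3 := NK z2 Hz22). apply Cmod_gt_0 in K3.
apply (Rmult_le_compat_r (Cmod (K z2))) in Mx; [|lra]. rewrite Rinv_l in Mx by lra. lra.
Qed.

(** Taylor's formula in Caratheodory's form: the second order slope extends
    continuously to c.  It gives psi its value at c in the next proof. *)
Lemma taylor_2 h c R : 0 < R -> holo h c R -> exists s, Ccont s c /\
  s c = (/ 2 * C_derive (C_derive h) c)%C /\
  forall w, h w = (h c + C_derive h c * (w - c) + s w * ((w - c) * (w - c)))%C.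
Proof.
intros HR Hh.
assert (Hc : Cmod (c - c) < R) by (rewrite Cminus_diag, Cmod_0; exact HR).
set (h1 := C_derive h c). set (h2 := C_derive (C_derive h) c).
assert (D2 : Cder (C_derive h) c h2) by (apply (holo_der _ c R); [now apply holo_derive|exact
  Hc]).
set (s := fun w => if Ceq_dec w c then (/ 2 * h2)%C else ((h w - h c - h1 * (w - c)) / ((w - c)
  * (w - c)))%C).
assert (Sc : s c = (/ 2 * h2)%C) by (unfold s; destruct (Ceq_dec c c); congruence).
exists s. split; [|split; [exact Sc|]].
- apply Ccont_eps. rewrite Sc. intros e He.
  destruct (proj1 (Cder_eps _ _ _) D2 (e / 2)) as (d & Hd & K); [lra|].
  exists (Rmin d R). split; [now apply Rmin_glb_lt|]. intros w Hw.
  unfold s. destruct (Ceq_dec w c) as [->|N]; [rewrite Cminus_diag, Cmod_0; exact He|].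
  apply Cminus_neq_0 in N. set (k := (w - c)%C) in *.
  assert (Hk1 := Rlt_le_trans _ _ _ Hw (Rmin_l _ _)).
  assert (Hk2 := Rlt_le_trans _ _ _ Hw (Rmin_r _ _)).
  assert (B : Cmod ((h (c + k)%C - h1 * (c + k) - / 2 * h2 * ((c + k - c) * (c + k - c)))
      - (h c - h1 * c - / 2 * h2 * ((c - c) * (c - c)))) <= e / 2 * Cmod k * Cmod k).
  { apply (segment_mean_value (fun w => h w - h1 * w - / 2 * h2 * ((w - c) * (w - c)))%C).
    intros t Ht.
    assert (Bt : Cmod (c + RtoC t * k - c) <= Cmod k).
    { replace (c + t * k - c)%C with (RtoC t * k)%C by ring.
      rewrite Cmod_mult, Cmod_R, Rabs_pos_eq by lra.
      assert (P := Cmod_ge_0 k). nra. }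
    exists (C_derive h (c + RtoC t * k) - h1 - h2 * (c + RtoC t * k - c))%C. split.
    - eapply Cder_eq.
      + apply Cder_minus; [apply Cder_minus|].
        * apply (holo_der h c R); [exact Hh|lra].
        * apply Cder_scal, Cder_id.
        * apply Cder_scal. apply Cder_mult; (apply Cder_minus; [apply Cder_id|apply Cder_const]).
      + cbv beta. Cfield.
    - eapply Rle_trans; [apply K; lra|]. apply Rmult_le_compat_l; lra. }
  replace (c + k)%C with w in B by (unfold k; ring).
  replace (h w - h1 * w - / 2 * h2 * ((w - c) * (w - c)) - (h c - h1 * c - / 2 * h2 * ((c - c)
    * (c - c))))%C
    with (((h w - h c - h1 * k) / (k * k) - / 2 * h2) * (k * k))%C in B.
  2:{ unfold k in *. Cfield. }
  rewrite !Cmod_mult in B. apply Cmod_gt_0 in N.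
  assert (P : 0 < Cmod k * Cmod k) by nra. nra.
- intros w. unfold s. destruct (Ceq_dec w c) as [->|N]; [ring|]. apply Cminus_neq_0 in N. field.
  exact N.
Qed.

(** With the first order slope p of h, its second order slope s and the slope
    r of h', the function psi = (h'(z) (z-c) / (h(z) - h(c)) - 1) / (z-c) equals
    (r - s) / p, which is continuous at c with value h''(c) / (2 h'(c)).  On the
    circle |z - c| = R/4, the function h - h(c) is injective without zeros on the
    disc of radius |z - c| about z, which bounds psi there. *)
Lemma univalent_pre_schwarzian h : analytic h ->
  (forall z w, Disk z -> Disk w -> h z = h w -> z = w) ->
  (forall z, Disk z -> C_derive h z <> 0) ->
  forall c, Disk c -> Cmod (C_derive (C_derive h) c / C_derive h c) * (1 - Cmod c)
    <= 8 * (log_derivative_constant + 1).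
Proof.
intros Ha Hi Hn c Hc. unfold Disk in *.
assert (Hh : holo h 0 1).
{ intros z Hz. replace (z - 0)%C with z in Hz by ring. destruct (Ha z Hz) as [l Hl]. exists l.
  now apply Cder_is_derive. }
set (R := 1 - Cmod c). assert (HR : 0 < R) by (unfold R; lra).
assert (HhR : holo h c R) by now apply holo_disk_sub.
assert (HcR : Cmod (c - c) < R) by (rewrite Cminus_diag, Cmod_0; exact HR).
assert (In : forall z, Cmod (z - c) < R -> Cmod z < 1).
{ intros z Hz. assert (T := Cmod_triangle_sub z c). unfold R in Hz. lra. }
destruct (taylor_2 h c R HR HhR) as (s & Cs & Sc & Es).
set (h1 := C_derive h c) in *. set (h2 := C_derive (C_derive h) c) in *.
assert (N1 : h1 <> 0) by now apply Hn.
assert (D2 : Cder (C_derive h) c h2) by (apply (holo_der _ c R); [now apply holo_derive|exact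
  HcR]).
destruct D2 as (r & Cr & Rc & Er). fold h1 in Er.
set (p := fun z => (h1 + s z * (z - c))%C).
set (psi := fun z => ((r z - s z) / p z)%C).
assert (Cp : Ccont p c).
{ apply Ccont_plus; [apply Ccont_const|]. apply Ccont_mult; [exact Cs|].
  apply Ccont_plus; [apply Ccont_id|apply Ccont_const]. }
assert (Pc : p c = h1) by (unfold p; rewrite Cminus_diag; ring).
assert (Ep : forall z, (h z - h c)%C = (p z * (z - c))%C).
{ intros z. rewrite (Es z). unfold p. ring. }
assert (Np : forall z, Cmod (z - c) < R -> z <> c -> (h z - h c)%C <> 0 /\ p z <> 0).
{ intros z Hz N. assert (K : (h z - h c)%C <> 0).
  { intros Z. apply N. apply Hi; auto. replace (h z) with (h z - h c + h c)%C by ring. rewrite Z.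
    ring. }
  split; [exact K|]. intros Z. apply K. rewrite (Ep z), Z. ring. }
assert (Epsi : forall z, Cmod (z - c) < R -> z <> c ->
  psi z = ((C_derive h z * (z - c) / (h z - h c) - 1) / (z - c))%C).
{ intros z Hz N. destruct (Np z Hz N) as [K1 K2]. assert (N' := Cminus_neq_0 _ _ N).
  rewrite Ep, (Er z). unfold psi, p in *. field. split; auto. }
assert (B : Cmod (psi c) <= (log_derivative_constant + 1) / (R / 4)).
{ apply (circle_max psi c R (R / 4)); [lra| | |].
  - intros z [Hz1 Hz2].
    assert (N : z <> c) by (intros ->; rewrite Cminus_diag, Cmod_0 in Hz1; lra).
    eexists. apply (Cder_ext_loc (fun z => (C_derive h z * (z - c) / (h z - h c) - 1) / (z -
      c))%C).
    + exists (Rmin (Cmod (z - c)) (R - Cmod (z - c))). split; [apply Rmin_glb_lt; lra|].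
      intros w Hw. symmetry. apply Epsi.
      * assert (H2 := Rlt_le_trans _ _ _ Hw (Rmin_r _ _)).
        replace (w - c)%C with ((w - z) + (z - c))%C by ring.
        eapply Rle_lt_trans; [apply Cmod_triangle|]. lra.
      * intros ->. assert (H1 := Rlt_le_trans _ _ _ Hw (Rmin_l _ _)).
        rewrite Cmod_minus_sym in H1. lra.
    + apply Cder_div; [apply Cder_minus; [apply Cder_div; [apply Cder_mult|apply
        Cder_minus|]|]|apply Cder_minus|].
      * apply (holo_der (C_derive h) c R); [now apply holo_derive|exact Hz2].
      * apply Cder_minus; [apply Cder_id|apply Cder_const].
      * apply (holo_der h c R); [exact HhR|exact Hz2].
      * apply Cder_const.
      * apply Np; auto.
      * apply Cder_const.
      * apply Cder_id.
      * apply Cder_const.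
      * now apply Cminus_neq_0.
  - unfold psi. apply Ccont_mult; [|apply Ccont_inv; [exact Cp|rewrite Pc; exact N1]].
    apply Ccont_plus; [exact Cr|]. apply (Ccont_ext_loc (fun w => (- (1)) * s w)%C).
    + exists 1. split; [lra|]. intros; ring.
    + apply Ccont_mult; [apply Ccont_const|exact Cs].
  - intros z Hz. assert (Hz2 : Cmod (z - c) < R) by lra.
    assert (N : z <> c) by (intros ->; rewrite Cminus_diag, Cmod_0 in Hz; lra).
    assert (N' := Cminus_neq_0 _ _ N). destruct (Np z Hz2 N) as [K1 K2].
    rewrite Epsi by auto. rewrite Cmod_div, Hz by auto. unfold Rdiv at 1 3.
    apply Rmult_le_compat_r; [left; apply Rinv_0_lt_compat; lra|].
    eapply Rle_trans; [apply Cmod_triangle_minus|]. rewrite Cmod_1. apply Rplus_le_compat_r.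
    assert (Sub : forall w, Cmod (w - z) < R / 4 -> Cmod (w - c) < R).
    { intros w Hw. replace (w - c)%C with ((w - z) + (z - c))%C by ring.
      eapply Rle_lt_trans; [apply Cmod_triangle|]. lra. }
    assert (NV := nonvanishing_injective_log_derivative (fun w => h w - h c)%C z (R / 4)).
    assert (DG : Cder (fun w => h w - h c)%C z (C_derive h z - 0)).
    { apply Cder_minus; [apply (holo_der h c R); auto|apply Cder_const]. }
    rewrite (Cder_C_derive _ _ _ DG) in NV.
    replace (C_derive h z * (z - c) / (h z - h c))%C with ((C_derive h z - 0) / (h z - h c) *
      (z - c))%C by (field; exact K1).
    rewrite Cmod_mult, Hz. apply NV; [lra| | |].
    + intros w Hw. destruct (HhR w (Sub w Hw)) as [l Hl]. eexists.
      apply Cder_minus; [exact Hl|apply Cder_const].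
    + intros w Hw. apply Np; [auto|]. intros ->. rewrite Cmod_minus_sym in Hw. lra.
    + intros w v Hw Hv E. apply Hi; auto. replace (h w) with (h w - h c + h c)%C by ring.
      rewrite E. ring. }
unfold psi in B. rewrite Pc, Sc, Rc in B.
replace ((h2 - / 2 * h2) / h1)%C with (RtoC (/ 2) * (h2 / h1))%C in B.
2:{ rewrite RtoC_inv by lra. Cfield. }
rewrite Cmod_mult, Cmod_R, Rabs_pos_eq in B by lra.
apply (Rmult_le_compat_r R) in B; [|lra].
replace ((log_derivative_constant + 1) / (R / 4) * R) with (4 * (log_derivative_constant + 1))
  in B by (field; lra). lra.
Qed.

(** * Weighted estimates on the disk *)

(** On the disk 1 - |z| <= 1 - |z|^2 <= 2 (1 - |z|), so the hyperbolic weight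
    may be replaced by the distance to the boundary. *)
Lemma schwarzian_norm_finite S : Rbar_lt (schwarzian_norm S) p_infty <->
  exists K, 0 <= K /\ forall z, Disk z -> Cmod (S z) <= K * / (1 - Cmod z) ^ 2.
Proof.
unfold schwarzian_norm.
set (E := fun r => exists z, Disk z /\ r = (1 - Cmod z ^ 2) ^ 2 * Cmod (S z)).
destruct (Lub_Rbar_correct E) as [U L]. split.
- intros H. assert (exists k : R, forall r, E r -> r <= k) as [k Hk].
  { destruct (Lub_Rbar E) as [k| |]; [exists k; exact U|easy|].
    exists 0. intros r Hr. destruct (U r Hr). }
  exists (Rabs k). split; [apply Rabs_pos|]. intros z Hz.
  assert (B := Hk _ (ex_intro _ z (conj Hz eq_refl))). unfold Disk in Hz.
  assert (P := Cmod_ge_0 z). assert (Q := Cmod_ge_0 (S z)). assert (A := Rle_abs k).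
  assert (0 < (1 - Cmod z) ^ 2) by (apply pow_lt; lra).
  apply (Rmult_le_reg_r ((1 - Cmod z) ^ 2)); [easy|]. rewrite Rmult_assoc, Rinv_l by lra.
  assert ((1 - Cmod z) ^ 2 <= (1 - Cmod z ^ 2) ^ 2) by (apply pow_incr; nra). nra.
- intros (K & HK & H). apply Rbar_le_lt_trans with (4 * K); [|easy].
  apply L. intros r (z & Hz & ->). simpl Rbar_le. specialize (H z Hz). unfold Disk in Hz.
  assert (P := Cmod_ge_0 z). assert (Q := Cmod_ge_0 (S z)).
  assert (D : 0 < (1 - Cmod z) ^ 2) by (apply pow_lt; lra).
  apply (Rmult_le_compat_r ((1 - Cmod z) ^ 2)) in H; [|lra].
  rewrite Rmult_assoc, Rinv_l in H by lra.
  assert (I : (1 - Cmod z ^ 2) ^ 2 <= 4 * (1 - Cmod z) ^ 2).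
  { replace (4 * (1 - Cmod z) ^ 2) with ((2 * (1 - Cmod z)) ^ 2) by ring. apply pow_incr. nra. }
  nra.
Qed.

Lemma analytic_holo f : analytic f -> holo f 0 1.
Proof.
intros Ha z Hz. replace (z - 0)%C with z in Hz by ring.
destruct (Ha z Hz) as [l Hl]. exists l. now apply Cder_is_derive.
Qed.

Lemma holo_disk_der f z : holo f 0 1 -> Disk z -> Cder f z (C_derive f z).
Proof. intros H Hz. apply (holo_der f 0 1); [exact H|]. replace (z - 0)%C with z by ring.
exact Hz. Qed.

Lemma disk_cauchy F M : 0 <= M -> holo F 0 1 -> (forall z, Disk z -> Cmod (F z) <= M) ->
  forall z, Disk z -> Cmod (C_derive F z) <= 2 * M / (1 - Cmod z).
Proof.
intros HM HF HB z Hz. assert (HFz := holo_disk_sub F z HF). unfold Disk in *.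
apply (cauchy_estimate F z); [lra|exact HFz| |now apply holo_disk_der].
intros w Hw. apply HB. assert (T := Cmod_triangle_sub w z). lra.
Qed.

(** Cauchy's estimate on the disc of half the distance to the boundary, where
    the weight at most doubles. *)
Lemma disk_cauchy_weighted F M : 0 <= M -> holo F 0 1 ->
  (forall z, Disk z -> Cmod (F z) <= M / (1 - Cmod z)) ->
  forall z, Disk z -> Cmod (C_derive F z) <= 8 * M * / (1 - Cmod z) ^ 2.
Proof.
intros HM HF HB z Hz. assert (HFz := holo_disk_sub F z HF). unfold Disk in *.
set (d := 1 - Cmod z) in *. assert (Hd : 0 < d) by (unfold d; lra).
replace (8 * M * / d ^ 2) with (2 * (M / (d / 2)) / (d / 2)) by (field; lra).
apply (cauchy_estimate F z); [lra| | |now apply holo_disk_der].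
- apply (holo_sub F z d); [exact HFz|]. rewrite Cminus_diag, Cmod_0. lra.
- intros w Hw. assert (T := Cmod_triangle_sub w z). unfold d in Hw.
  eapply Rle_trans; [apply HB; lra|]. apply Rmult_le_compat_l; [exact HM|].
  apply Rinv_le_contravar; unfold d; lra.
Qed.

(** * Wirtinger derivatives *)

(** Keeping the two partial derivatives instead of the Wirtinger derivative
    makes conjugation and the modulus no harder than products. *)
Definition has_partials (F : C -> C) (z A B : C) : Prop :=
  Rder (fun t => F (t, Im z)) (Re z) A /\ Rder (fun t => F (Re z, t)) (Im z) B.

Lemma has_partials_wirtinger F z A B : has_partials F z A B -> wirtinger F z = (/ 2 * (A - Ci *
  B))%C.
Proof.
intros [[A1 A2] [B1 B2]]. unfold wirtinger, partial_x, partial_y.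
replace (Derive (fun t => Re (F (t, Im z))) (Re z), Derive (fun t => Im (F (t, Im z))) (Re z))
  with A.
2:{ apply injective_projections; symmetry; apply is_derive_unique; assumption. }
replace (Derive (fun t => Re (F (Re z, t))) (Im z), Derive (fun t => Im (F (Re z, t))) (Im z))
  with B.
2:{ apply injective_projections; symmetry; apply is_derive_unique; assumption. }
reflexivity.
Qed.

Lemma wirtinger_ext_disk F G z : Disk z -> (forall w, Disk w -> F w = G w) ->
  wirtinger F z = wirtinger G z.
Proof.
unfold Disk. intros Hz E. destruct z as [x y].
assert (Hd : 0 < 1 - Cmod (x, y)) by lra.
assert (K : forall w, Cmod (w - (x, y)) < 1 - Cmod (x, y) -> F w = G w).
{ intros w Hw. apply E. assert (T := Cmod_triangle_sub w (x, y)). lra. }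
assert (Lx : locally x (fun s => F (s, y) = G (s, y))).
{ exists (mkposreal _ Hd). intros s Hs. apply K. eapply Rle_lt_trans; [apply Cmod_le_abs|]. cbn.
  replace (y + - y) with 0 by ring. rewrite Rabs_R0, Rplus_0_r. exact Hs. }
assert (Ly : locally y (fun s => F (x, s) = G (x, s))).
{ exists (mkposreal _ Hd). intros s Hs. apply K. eapply Rle_lt_trans; [apply Cmod_le_abs|]. cbn.
  replace (x + - x) with 0 by ring. rewrite Rabs_R0, Rplus_0_l. exact Hs. }
assert (Ex : partial_x F (x, y) = partial_x G (x, y)).
{ destruct Lx as [e L].
  apply injective_projections; apply Derive_ext_loc; exists e;
  intros s Hs; [exact (f_equal fst (L s Hs))|exact (f_equal snd (L s Hs))]. }
assert (Ey : partial_y F (x, y) = partial_y G (x, y)).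
{ destruct Ly as [e L].
  apply injective_projections; apply Derive_ext_loc; exists e;
  intros s Hs; [exact (f_equal fst (L s Hs))|exact (f_equal snd (L s Hs))]. }
unfold wirtinger. now rewrite Ex, Ey.
Qed.

Lemma has_partials_Cder F z l : Cder F z l -> has_partials F z l (l * Ci).
Proof.
intros H. destruct z as [x y]. split; cbn [Re Im fst snd].
- eapply Rder_eq; [apply (Rder_comp F (fun t => (t, y)) x l 1 H (Rder_hline y x))|ring].
- apply (Rder_comp F (fun t => (x, t)) y l Ci H (Rder_vline x y)).
Qed.

Lemma C_eta (z : C) : (Re z, Im z) = z.
Proof. now destruct z. Qed.

Lemma has_partials_plus F G z A B A' B' : has_partials F z A B -> has_partials G z A' B' ->
  has_partials (fun w => F w + G w)%C z (A + A') (B + B').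
Proof.
intros [H1 H2] [K1 K2]. split.
- exact (Rder_plus _ _ _ _ _ H1 K1).
- exact (Rder_plus _ _ _ _ _ H2 K2).
Qed.

Lemma has_partials_mult F G z A B A' B' : has_partials F z A B -> has_partials G z A' B' ->
  has_partials (fun w => F w * G w)%C z (A * G z + F z * A') (B * G z + F z * B').
Proof.
intros [H1 H2] [K1 K2]. split.
- assert (Q := Rder_mult _ _ _ _ _ H1 K1). cbv beta in Q. rewrite C_eta in Q. exact Q.
- assert (Q := Rder_mult _ _ _ _ _ H2 K2). cbv beta in Q. rewrite C_eta in Q. exact Q.
Qed.

Lemma has_partials_conj F z A B : has_partials F z A B -> has_partials (fun w => Cconj (F w)) z
  (Cconj A) (Cconj B).
Proof. intros [H1 H2]. split; [exact (Rder_conj _ _ _ H1)|exact (Rder_conj _ _ _ H2)]. Qed.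

Lemma has_partials_inv (F : C -> C) z A B : F z <> 0 -> has_partials F z A B ->
  has_partials (fun w => / F w)%C z (- A / (F z * F z)) (- B / (F z * F z)).
Proof.
intros N [H1 H2].
assert (D := Cder_inv (fun w => w) (F z) 1 (Cder_id _) N). cbv beta in D.
split; (eapply Rder_eq; [eapply (Rder_comp (fun w => / w)%C); [rewrite C_eta; exact
  D|eassumption]|field; exact N]).
Qed.

Lemma is_derive_half_ln (x y : R -> R) t x' y' : is_derive x t x' -> is_derive y t y' ->
  0 < x t * x t + y t * y t ->
  is_derive (fun s => / 2 * ln (x s * x s + y s * y s)) t
    ((x t * x' + y t * y') / (x t * x t + y t * y t)).
Proof.
intros Hx Hy P. auto_derive.
- repeat split; try (eexists; eassumption). exact P.
- rewrite (is_derive_unique (fun s : R => x s) _ _ Hx), (is_derive_unique (fun s : R => y s) _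
    _ Hy).
  field. lra.
Qed.

(** At z = 0 both sides vanish, since ln 0 = 0 by convention. *)
Lemma ln_Cmod z : ln (Cmod z) = / 2 * ln (fst z * fst z + snd z * snd z).
Proof.
rewrite <- Cmod_sqr. destruct (Req_dec (Cmod z) 0) as [E|N].
- rewrite E, Rmult_0_l. assert (L : ln 0 = 0).
  { unfold ln. destruct (Rlt_dec 0 0) as [L|L]; [exfalso; lra|reflexivity]. }
  rewrite L. ring.
- assert (P := Cmod_ge_0 z). rewrite ln_mult by lra. field.
Qed.

Lemma Rder_ln_Cmod (g : R -> C) t v : g t <> 0 -> Rder g t v ->
  Rder (fun s => RtoC (ln (Cmod (g s)))) t (RtoC (Re (v / g t)%C)).
Proof.
intros N [H1 H2].
assert (P : 0 < fst (g t) * fst (g t) + snd (g t) * snd (g t)).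
{ rewrite <- Cmod_sqr. apply Cmod_gt_0 in N. nra. }
split; cbn.
- apply (is_derive_ext (fun s => / 2 * ln (fst (g s) * fst (g s) + snd (g s) * snd (g s)))).
  + intros s. symmetry. apply ln_Cmod.
  + assert (D := is_derive_half_ln _ _ _ _ _ H1 H2 P). cbv beta in D.
    match type of D with is_derive _ _ ?a => match goal with |- is_derive _ _ ?b => replace b
      with a end end; [exact D|].
    destruct (g t) as [a b]. cbn in *. field. lra.
- apply @is_derive_const.
Qed.

Lemma has_partials_ln_Cmod (F : C -> C) z A B : F z <> 0 -> has_partials F z A B ->
  has_partials (fun w => RtoC (ln (Cmod (F w)))) z (RtoC (Re (A / F z)%C)) (RtoC (Re (B / F
    z)%C)).
Proof.
intros N [H1 H2]. split.
- assert (Q := Rder_ln_Cmod (fun t => F (t, Im z)) (Re z) A). cbv beta in Q. rewrite C_eta in Q.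
  auto.
- assert (Q := Rder_ln_Cmod (fun t => F (Re z, t)) (Im z) B). cbv beta in Q. rewrite C_eta in Q.
  auto.
Qed.

(** * The Schwarzian of a harmonic mapping *)

Definition pre_schwarzian (h : C -> C) (z : C) : C :=
  (C_derive (C_derive h) z / C_derive h z)%C.

Definition one_plus_norm2 (q : C -> C) (z : C) : C := (1 + q z * Cconj (q z))%C.

Lemma one_plus_norm2_real q z : one_plus_norm2 q z = RtoC (1 + Cmod (q z) ^ 2).
Proof. unfold one_plus_norm2. now rewrite <- Cmod2_conj, RtoC_plus. Qed.
Lemma one_plus_norm2_neq_0 q z : one_plus_norm2 q z <> 0.
Proof. rewrite one_plus_norm2_real. intros Z. apply RtoC_inj in Z. nra. Qed.
Lemma Cmod_one_plus_norm2 q z : 1 <= Cmod (one_plus_norm2 q z).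
Proof. rewrite one_plus_norm2_real, Cmod_R. eapply Rle_trans; [|apply Rle_abs]. nra. Qed.
Lemma one_plus_norm2_conj q z : Cconj (one_plus_norm2 q z) = one_plus_norm2 q z.
Proof. unfold one_plus_norm2. rewrite Cplus_conj, Cmult_conj, Cconj_conj. unfold Cconj at 1. cbn.
rewrite Ropp_0. change (1, 0) with (RtoC 1). ring. Qed.

Lemma holo_pre_schwarzian h : holo h 0 1 -> (forall z, Disk z -> C_derive h z <> 0) ->
  holo (pre_schwarzian h) 0 1.
Proof.
intros Hh Hn z Hz. assert (Hz' : Disk z) by (unfold Disk; replace (z - 0)%C with z in Hz by
  ring; exact Hz).
destruct (holo_derive _ _ _ Hh z Hz) as [l Hl].
destruct (holo_derive _ _ _ (holo_derive _ _ _ Hh) z Hz) as [m Hm].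
eexists. apply Cder_div; [exact Hm|exact Hl|auto].
Qed.

Lemma has_partials_one_plus_norm2 q z : holo q 0 1 -> Disk z -> let q' := C_derive q z in
  has_partials (one_plus_norm2 q) z
  (q' * Cconj (q z) + q z * Cconj q') (q' * Ci * Cconj (q z) + q z * Cconj (q' * Ci)).
Proof.
intros Hq Hz q'. assert (D := has_partials_Cder _ _ _ (holo_disk_der q z Hq Hz)). fold q' in D.
assert (D1 := has_partials_Cder _ _ _ (Cder_const 1 z)).
assert (D2 := has_partials_plus _ _ _ _ _ _ _ D1 (has_partials_mult _ _ _ _ _ _ _ D
  (has_partials_conj _ _ _ _ D))).
cbv beta in D2. destruct D2 as [D3 D4].
split; [eapply Rder_eq; [exact D3|ring]|eapply Rder_eq; [exact D4|ring]].
Qed.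

(** The factor 1 + |q|^2 is positive, so sigma is ln |h' (1 + |q|^2)|, a single
    logarithm of a modulus. *)
Lemma wirtinger_log_metric h q z : holo h 0 1 -> holo q 0 1 ->
  (forall z, Disk z -> C_derive h z <> 0) -> Disk z ->
  wirtinger (fun w => RtoC (ln (Cmod (C_derive h w * one_plus_norm2 q w)))) z
   = (/ 2 * pre_schwarzian h z + C_derive q z * Cconj (q z) * / one_plus_norm2 q z)%C.
Proof.
intros Hh Hq Hn Hz. assert (N0 := one_plus_norm2_neq_0 q z). assert (H0 := Hn z Hz).
assert (D1 := has_partials_Cder _ _ _ (holo_disk_der _ z (holo_derive _ _ _ Hh) Hz)).
assert (D2 := has_partials_mult _ _ _ _ _ _ _ D1 (has_partials_one_plus_norm2 q z Hq Hz)).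
assert (D3 := has_partials_ln_Cmod (fun w => C_derive h w * one_plus_norm2 q w)%C z _ _
  (Cmult_neq_0 _ _ H0 N0) D2).
rewrite (has_partials_wirtinger _ _ _ _ D3). cbv zeta.
rewrite !re_alt.
assert (H0' : Cconj (C_derive h z) <> 0).
{ intros Z. apply H0. rewrite <- (Cconj_conj (C_derive h z)), Z. unfold Cconj; cbn.
  now rewrite Ropp_0. }
rewrite !Cdiv_conj by (apply Cmult_neq_0; auto).
repeat (rewrite Cplus_conj || rewrite Cmult_conj || rewrite Cconj_conj || rewrite
  one_plus_norm2_conj).
replace (Cconj Ci) with (- Ci)%C by (unfold Cconj, Ci, Copp; cbn; f_equal; ring).
unfold pre_schwarzian. set (h1 := C_derive h z) in *. set (h2 := C_derive (C_derive h) z).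
set (q1 := C_derive q z). set (n := one_plus_norm2 q z) in *.
assert (I2 : (Ci * Ci)%C = (-(1))%C) by (unfold Ci, Cmult, Copp; cbn; unfold RtoC; f_equal; ring).
(* The squares of i are kept apart, since field does not know that i^2 = -1. *)
transitivity (/ 2 * ( / 2 * ((h2 / h1 + Cconj h2 / Cconj h1) + 2 * (q1 * Cconj (q z) + q z *
  Cconj q1) / n)
  - / 2 * ((Ci * Ci) * (h2 / h1 - Cconj h2 / Cconj h1) + 2 * (Ci * Ci) * (q1 * Cconj (q z) - q
      z * Cconj q1) / n)))%C.
- Cfield.
- rewrite I2. Cfield.
Qed.

Lemma wirtinger_sigma_z h q z : holo h 0 1 -> holo q 0 1 ->
  (forall z, Disk z -> C_derive h z <> 0) -> Disk z ->
  wirtinger (fun w => / 2 * pre_schwarzian h w + C_derive q w * Cconj (q w) * / one_plus_norm2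
    q w)%C z
   = (/ 2 * C_derive (pre_schwarzian h) z + C_derive (C_derive q) z * Cconj (q z) /
     one_plus_norm2 q z
      - (C_derive q z * Cconj (q z) / one_plus_norm2 q z) ^ 2)%C.
Proof.
intros Hh Hq Hn Hz. assert (N0 := one_plus_norm2_neq_0 q z).
assert (D1 := has_partials_Cder _ _ _ (Cder_scal (/ 2) _ _ _ (holo_disk_der _ z
  (holo_pre_schwarzian h Hh Hn) Hz))).
assert (D2 := has_partials_Cder _ _ _ (holo_disk_der _ z (holo_derive _ _ _ Hq) Hz)).
assert (D3 := has_partials_conj _ _ _ _ (has_partials_Cder _ _ _ (holo_disk_der _ z Hq Hz))).
assert (D4 := has_partials_inv _ _ _ _ N0 (has_partials_one_plus_norm2 q z Hq Hz)).
assert (D5 := has_partials_plus _ _ _ _ _ _ _ D1 (has_partials_mult _ _ _ _ _ _ _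
  (has_partials_mult _ _ _ _ _ _ _ D2 D3) D4)).
rewrite (has_partials_wirtinger _ _ _ _ D5). cbv zeta beta.
repeat (rewrite Cmult_conj).
replace (Cconj Ci) with (- Ci)%C by (unfold Cconj, Ci, Copp; cbn; f_equal; ring).
set (p1 := C_derive (pre_schwarzian h) z). set (q1 := C_derive q z).
set (q2 := C_derive (C_derive q) z). set (n := one_plus_norm2 q z) in *.
assert (I2 : (Ci * Ci)%C = (-(1))%C) by (unfold Ci, Cmult, Copp; cbn; unfold RtoC; f_equal; ring).
set (qb := Cconj (q z)). set (q1b := Cconj q1).
(* As above, the squares of i are kept apart for field. *)
transitivity (/ 2 * ((/ 2 * p1 + (q2 * qb + q1 * q1b) / n - q1 * qb * (q1 * qb + q z * q1b) /
  (n * n))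
   - (Ci * Ci) * (/ 2 * p1 + (q2 * qb - q1 * q1b) / n - q1 * qb * (q1 * qb - q z * q1b) / (n *
       n))))%C.
- Cfield.
- rewrite I2. Cfield.
Qed.

Lemma harmonic_schwarzian_formula f q z : analytic q ->
  locally_univalent_orientation_preserving f ->
  (forall z, Disk z -> dilatation f z = (q z ^ 2)%C) -> Disk z ->
  harmonic_schwarzian f z = (schwarzian (hpart f) z
    + 2 * (Cconj (q z) / one_plus_norm2 q z)
        * (C_derive (C_derive q) z - C_derive q z * pre_schwarzian (hpart f) z)
    - 4 * (C_derive q z * Cconj (q z) / one_plus_norm2 q z) ^ 2)%C.
Proof.
intros Aq Hlu Hdil Hz.
assert (Hh := analytic_holo _ (hpart_analytic f)). assert (Hq := analytic_holo _ Aq).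
set (h := hpart f) in *. set (g := gpart f).
assert (Hn : forall z, Disk z -> C_derive h z <> 0).
{ intros w Hw. apply Cmod_gt_0. eapply Rle_lt_trans; [apply Cmod_ge_0|apply (Hlu w Hw)]. }
assert (Es : forall w, Disk w -> RtoC (log_metric f w) = RtoC (ln (Cmod (C_derive h w *
  one_plus_norm2 q w)))).
{ intros w Hw. unfold log_metric. fold h g. f_equal. f_equal.
  rewrite Cmod_mult, one_plus_norm2_real, Cmod_R, Rabs_pos_eq by (assert (P := Cmod_ge_0 (q
    w)); nra).
  rewrite <- Cmod_pow, <- (Hdil w Hw). unfold dilatation. fold h g. rewrite Cmod_div by auto.
  field. apply Rgt_not_eq, Cmod_gt_0. auto. }
assert (W1 : forall w, Disk w -> wirtinger (fun w => RtoC (log_metric f w)) w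
  = (/ 2 * pre_schwarzian h w + C_derive q w * Cconj (q w) * / one_plus_norm2 q w)%C).
{ intros w Hw. rewrite <- wirtinger_log_metric by auto.
  apply (wirtinger_ext_disk _ _ w Hw Es). }
unfold harmonic_schwarzian. cbv zeta.
rewrite (wirtinger_ext_disk _ _ z Hz W1), W1, wirtinger_sigma_z by auto.
unfold schwarzian. cbv zeta. fold (pre_schwarzian h).
change (C_derive (C_derive h) z / C_derive h z)%C with (pre_schwarzian h z).
change (fun w => C_derive (C_derive h) w / C_derive h w)%C with (pre_schwarzian h).
assert (N0 := one_plus_norm2_neq_0 q z). Cfield.
Qed.

(** * Comparison of the two norms *)

Definition quadratically_bounded (S : C -> C) : Prop :=
  exists K, 0 <= K /\ forall z, Disk z -> Cmod (S z) <= K * / (1 - Cmod z) ^ 2.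

Definition linearly_bounded (P : C -> C) : Prop :=
  exists M, 0 <= M /\ forall z, Disk z -> Cmod (P z) <= M / (1 - Cmod z).

Lemma quadratically_bounded_schwarzian h : holo (pre_schwarzian h) 0 1 ->
  linearly_bounded (pre_schwarzian h) -> quadratically_bounded (schwarzian h).
Proof.
intros HP (M & HM & B). exists (8 * M + M * M). split; [nra|]. intros z Hz.
assert (D := disk_cauchy_weighted _ M HM HP B z Hz). specialize (B z Hz). unfold Disk in Hz.
unfold schwarzian. cbv zeta. fold (pre_schwarzian h).
change (C_derive (C_derive h) z / C_derive h z)%C with (pre_schwarzian h z).
change (fun w => C_derive (C_derive h) w / C_derive h w)%C with (pre_schwarzian h).
eapply Rle_trans; [apply Cmod_triangle_minus|].
rewrite Cmod_mult, Cmod_pow, <- RtoC_inv, Cmod_R, Rabs_pos_eq by lra.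
rewrite Rmult_plus_distr_r. apply Rplus_le_compat; [exact D|].
assert (P := Cmod_ge_0 (pre_schwarzian h z)).
replace (M * M * / (1 - Cmod z) ^ 2) with ((M / (1 - Cmod z)) ^ 2) by (field; lra).
assert (Cmod (pre_schwarzian h z) ^ 2 <= (M / (1 - Cmod z)) ^ 2) by now apply pow_incr. nra.
Qed.

(** All coefficients of the formula are controlled by |q| <= 1: the function
    conj(q) / (1 + |q|^2) by 1, q' by 2/d and q'' by 16/d^2. *)
Lemma schwarzian_difference_bound f q : analytic q ->
  locally_univalent_orientation_preserving f ->
  (forall z, Disk z -> dilatation f z = (q z ^ 2)%C) ->
  forall z, Disk z ->
  Cmod (harmonic_schwarzian f z - schwarzian (hpart f) z) <=
    48 * (/ (1 - Cmod z) ^ 2 + Cmod (pre_schwarzian (hpart f) z) / (1 - Cmod z)).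
Proof.
intros Aq Hlu Hdil z Hz.
rewrite (harmonic_schwarzian_formula f q z Aq Hlu Hdil Hz).
assert (Hq := analytic_holo _ Aq).
assert (Bq : forall w, Disk w -> Cmod (q w) <= 1).
{ intros w Hw. specialize (Hlu w Hw). specialize (Hdil w Hw). unfold dilatation in Hdil.
  assert (P := Cmod_ge_0 (C_derive (gpart f) w)).
  apply (f_equal Cmod) in Hdil. rewrite Cmod_pow, Cmod_div in Hdil by (apply Cmod_gt_0; lra).
  assert (L : Cmod (q w) ^ 2 <= 1).
  { rewrite <- Hdil. apply (Rmult_le_reg_r (Cmod (C_derive (hpart f) w))); [lra|].
    unfold Rdiv. rewrite Rmult_assoc, Rinv_l; lra. }
  assert (Q := Cmod_ge_0 (q w)). nra. }
assert (D1 := disk_cauchy q 1 Rle_0_1 Hq Bq).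
assert (D2 := disk_cauchy_weighted _ (2 * 1) ltac:(lra) (holo_derive _ _ _ Hq) D1 z Hz).
specialize (D1 z Hz). specialize (Bq z Hz). unfold Disk in Hz.
set (p := pre_schwarzian (hpart f) z). set (q1 := C_derive q z) in *.
set (q2 := C_derive (C_derive q) z) in *.
set (d := 1 - Cmod z) in *. assert (Hd : 0 < d) by (unfold d; lra).
set (b := (Cconj (q z) / one_plus_norm2 q z)%C).
assert (Bb : Cmod b <= 1).
{ unfold b. rewrite Cmod_div, Cmod_conj by apply one_plus_norm2_neq_0.
  assert (B := Cmod_one_plus_norm2 q z).
  apply (Rmult_le_reg_r (Cmod (one_plus_norm2 q z))); [lra|]. unfold Rdiv.
  rewrite Rmult_assoc, Rinv_l; lra. }
replace (schwarzian (hpart f) z + 2 * b * (q2 - q1 * p) - 4 * (q1 * Cconj (q z) /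
  one_plus_norm2 q z) ^ 2 - schwarzian (hpart f) z)%C
  with (RtoC 2 * b * (q2 - q1 * p) - RtoC 4 * ((q1 * b) * (q1 * b)))%C.
2:{ unfold b. field. apply one_plus_norm2_neq_0. }
eapply Rle_trans; [apply Cmod_triangle_minus|].
rewrite !Cmod_mult, !Cmod_R, !Rabs_pos_eq by lra.
assert (T := Cmod_triangle_minus q2 (q1 * p)). rewrite Cmod_mult in T.
assert (P1 := Cmod_ge_0 q1). assert (P2 := Cmod_ge_0 p). assert (P3 := Cmod_ge_0 b).
assert (P4 := Cmod_ge_0 (q2 - q1 * p)).
assert (I : 0 < / d) by now apply Rinv_0_lt_compat.
unfold Rdiv in D1 |- *. rewrite <- pow_inv in D2 |- *.
set (x := / d) in *.
assert (E1 : Cmod q1 * Cmod p <= 2 * x * Cmod p) by (apply Rmult_le_compat_r; lra).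
assert (E2 : Cmod q1 * Cmod b <= 2 * x * 1) by (apply Rmult_le_compat; lra).
assert (E3 : 0 <= Cmod q1 * Cmod b) by now apply Rmult_le_pos.
assert (E4 : Cmod q1 * Cmod b * (Cmod q1 * Cmod b) <= (2 * x * 1) * (2 * x * 1)) by (apply
  Rmult_le_compat; lra).
assert (E5 : 2 * Cmod b * Cmod (q2 - q1 * p) <= 2 * 1 * Cmod (q2 - q1 * p)) by (apply
  Rmult_le_compat_r; lra).
assert (E6 : 0 <= x * Cmod p) by (apply Rmult_le_pos; lra).
nra.
Qed.

(** Here S stands for either Schwarzian, of h or of f; in both cases P solves
    the Riccati equation up to the error allowed in riccati_bound. *)
Lemma linearly_bounded_of_schwarzian h K S : 0 <= K -> holo (pre_schwarzian h) 0 1 ->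
  quadratically_bounded S ->
  (forall z, Disk z -> Cmod (S z - schwarzian h z) <=
    K * (/ (1 - Cmod z) ^ 2 + Cmod (pre_schwarzian h z) / (1 - Cmod z))) ->
  linearly_bounded (pre_schwarzian h).
Proof.
intros HK HP (L & HL & B) D.
assert (E : 1 < exp 2) by (rewrite <- exp_0; apply exp_increasing; lra).
exists (8 * (3 + 3 * (K + L) * (exp 2 - 1))). split.
{ assert (0 <= 3 * (K + L) * (exp 2 - 1)) by (apply Rmult_le_pos; lra). lra. }
intros z Hz.
assert (R := riccati_bound (pre_schwarzian h) (K + L) ltac:(lra) HP).
apply (Rmult_le_reg_r (1 - Cmod z)); [unfold Disk in Hz; lra|].
unfold Rdiv. rewrite Rmult_assoc, Rinv_l, Rmult_1_r by (unfold Disk in Hz; lra).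
apply R; [|exact Hz]. clear z Hz. intros z Hz.
specialize (B z Hz). specialize (D z Hz). unfold Disk in Hz.
replace (C_derive (pre_schwarzian h) z - / 2 * (pre_schwarzian h z * pre_schwarzian h z))%C with
  (S z - (S z - schwarzian h z))%C.
2:{ change (schwarzian h z) with (C_derive (pre_schwarzian h) z - / 2 * pre_schwarzian h z ^
  2)%C. ring. }
eapply Rle_trans; [apply Cmod_triangle_minus|].
assert (0 <= Cmod (pre_schwarzian h z) / (1 - Cmod z)).
{ unfold Rdiv. apply Rmult_le_pos; [apply Cmod_ge_0|]. left. apply Rinv_0_lt_compat. lra. }
assert (0 < / (1 - Cmod z) ^ 2) by (apply Rinv_0_lt_compat, pow_lt; lra). nra.
Qed.

Lemma quadratically_bounded_perturbation h K S : 0 <= K ->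
  linearly_bounded (pre_schwarzian h) -> quadratically_bounded (schwarzian h) ->
  (forall z, Disk z -> Cmod (S z - schwarzian h z) <=
    K * (/ (1 - Cmod z) ^ 2 + Cmod (pre_schwarzian h z) / (1 - Cmod z))) ->
  quadratically_bounded S.
Proof.
intros HK (M & HM & B) (L & HL & BS) D.
exists (K * (1 + M) + L). split; [nra|]. intros z Hz.
specialize (B z Hz). specialize (BS z Hz). specialize (D z Hz). unfold Disk in Hz.
assert (T := Cmod_triangle_sub (S z) (schwarzian h z)).
assert (I : 0 < / (1 - Cmod z)) by (apply Rinv_0_lt_compat; lra).
rewrite <- pow_inv in *. unfold Rdiv in *. set (x := / (1 - Cmod z)) in *.
assert (Cmod (pre_schwarzian h z) * x <= M * x * x) by (apply Rmult_le_compat_r; lra).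
nra.
Qed.

Theorem theorem3 (f : harmonic_mapping)
  (f_lu : locally_univalent_orientation_preserving f)
  (f_dil : exists q : C -> C, analytic q /\
     forall z : C, Disk z -> dilatation f z = (q z ^ 2)%C) :
  (Rbar_lt (schwarzian_norm (harmonic_schwarzian f)) p_infty <->
   Rbar_lt (schwarzian_norm (schwarzian (hpart f))) p_infty) /\
  (univalent (hpart f) ->
   Rbar_lt (schwarzian_norm (harmonic_schwarzian f)) p_infty).
Proof.
destruct f_dil as (q & Aq & Hdil).
assert (D := schwarzian_difference_bound f q Aq f_lu Hdil).
assert (Hn : forall z, Disk z -> C_derive (hpart f) z <> 0).
{ intros w Hw. apply Cmod_gt_0. eapply Rle_lt_trans; [apply Cmod_ge_0|apply (f_lu w Hw)]. }
assert (HP := holo_pre_schwarzian _ (analytic_holo _ (hpart_analytic f)) Hn).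
rewrite !schwarzian_norm_finite.
change (exists K, 0 <= K /\ forall z, Disk z -> Cmod (harmonic_schwarzian f z) <= K * / (1 -
  Cmod z) ^ 2)
  with (quadratically_bounded (harmonic_schwarzian f)).
change (exists K, 0 <= K /\ forall z, Disk z -> Cmod (schwarzian (hpart f) z) <= K * / (1 -
  Cmod z) ^ 2)
  with (quadratically_bounded (schwarzian (hpart f))).
assert (K : linearly_bounded (pre_schwarzian (hpart f)) -> quadratically_bounded
  (harmonic_schwarzian f)).
{ intros B. apply (quadratically_bounded_perturbation (hpart f) 48); auto; [lra|].
  now apply quadratically_bounded_schwarzian. }
split; [split|].
- intros B. apply quadratically_bounded_schwarzian; [exact HP|].
  apply (linearly_bounded_of_schwarzian _ 48 _ ltac:(lra) HP B D).
- intros B. apply K. apply (linearly_bounded_of_schwarzian _ 0 _ ltac:(lra) HP B).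
  intros z _. rewrite Cminus_diag, Cmod_0. lra.
- intros [Ha Hi]. apply K. exists (8 * (log_derivative_constant + 1)).
  split; [unfold log_derivative_constant; lra|]. intros z Hz.
  assert (U := univalent_pre_schwarzian _ Ha Hi Hn z Hz). unfold Disk in Hz.
  apply (Rmult_le_reg_r (1 - Cmod z)); [lra|]. unfold Rdiv.
  rewrite Rmult_assoc, Rinv_l, Rmult_1_r by lra.
  exact U.
Qed.
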